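(* A rich family of circles in $\mathbb{R}^3$ in a neighborhood of a point $P$ is rectifiable (near $P$) if and only if there exists a germ of a diffeomorphism $\Phi:(\mathbb{R}^3,P)\to\mathbb{R}P^3$ given by $$\Phi(X)=[S_1(X):S_2(X):S_3(X):S_4(X)],\qquad X=(x,y,z),$$ where $$S_i(X)=a_i(x^2+y^2+z^2)+b_ix+c_iy+d_iz+e_i\qquad (i=1,\ldots,4)$$ with real coefficients $a_i,b_i,c_i,d_i,e_i$, with non-zero Jacobian, such that every circle in the family is (near $P$) the inverse image of a line under $\Phi$.
   Context: A family of curves in $\mathbb{R}^3$ is called rectifiable near a point $P$ if there exist a neighborhood $U$ of $P$ and a diffeomorphism of $U$ onto its image taking all the curves in the family (more precisely, the portions of the curves contained in $U$) into straight lines (more precisely, into portions of lines lying in the image of $U$). A family $\Delta$ of circles in a domain $U\subset\mathbb{R}^3$ is called a rich family if there exists a subfamily $\Gamma\subseteq\Delta$ such that (1) for each $P\in U$ there exists a circle $\gamma\in\Gamma$ with $P\in\gamma$; (2) if $\gamma\in\Gamma$ and $P\in\gamma$, then there exists an open cone $K_P$ of directions at $P$, depending continuously on $P$, such that the tangent line of $\gamma$ at $P$ lies inside $K_P$ and any other direction in $K_P$ is the tangent direction at $P$ of a circle in $\Gamma$ passing through $P$. ''Every circle in the family is the inverse image of a line under the germ $\Phi$'' means: on some neighborhood $W$ of $P$ on which $\Phi$ is a diffeomorphism onto its image, the portion in $W$ of each circle of the family meeting $W$ equals $\{X\in W:\Phi(X)\in\ell\}$ for some projective line $\ell\subset\mathbb{R}P^3$.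 *)

(* Defs.v *)
From mathcomp Require Import all_boot all_order all_algebra.
From mathcomp Require Import all_classical all_reals all_analysis.
Set Implicit Arguments.
Unset Strict Implicit.
Unset Printing Implicit Defensive.
Import Order.TTheory GRing.Theory Num.Theory.
Import numFieldNormedType.Exports.
Local Open Scope classical_set_scope.
Local Open Scope ring_scope.

(* The library norm on 'rV[R]_n is the sup norm: it is only used for its
   topology, and Euclidean lengths and angles go through dot. *)
Definition dot (R : realType) n (u v : 'rV[R]_n) : R :=
  \sum_(i < n) u 0 i * v 0 i.

(* A circle has positive radius: straight lines are not circles. *)
Definition is_circle (R : realType) (g : set 'rV[R]_3) : Prop :=
  exists (c n : 'rV[R]_3) (r : R), [/\ n != 0, 0 < r &
    g = [set X | dot (X - c) n = 0 /\ dot (X - c) (X - c) = r ^+ 2]].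

Definition is_line (R : realType) (l : set 'rV[R]_3) : Prop :=
  exists (A v : 'rV[R]_3), v != 0 /\ l = range (fun t : R => A + t *: v).

(* v spans the tangent line of the curve g at X: v is the nonzero velocity at X
   of a motion along g. *)
Definition tangent_direction (R : realType) (g : set 'rV[R]_3)
    (X v : 'rV[R]_3) : Prop :=
  v != 0 /\ exists c : R -> 'rV[R]_3,
    [/\ c 0 = X, \forall t \near (0 : R), g (c t)
      & is_derive (0 : R) (1 : R) c v].

(* Directions are unoriented, i.e. lines through the origin, so that a cone is
   stable under negative scalars too. *)
Definition open_cone (R : realType) (K : set 'rV[R]_3) : Prop :=
  [/\ open K, ~ K 0 & forall (t : R) v, t != 0 -> K v -> K (t *: v)].

(* Two-sided continuity of a field of open cones: vectors inside K Q, as well as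
   vectors outside the closure of K Q, remain so under small changes of Q and of
   the vector. *)
Definition continuous_cone_field (R : realType) (V : set 'rV[R]_3)
    (K : 'rV[R]_3 -> set 'rV[R]_3) : Prop :=
  forall Q, V Q ->
    [/\ open_cone (K Q),
        forall v, K Q v ->
          \forall z \near ((Q, v) : 'rV[R]_3 * 'rV[R]_3), K z.1 z.2
      & forall v, ~ closure (K Q) v ->
          \forall z \near ((Q, v) : 'rV[R]_3 * 'rV[R]_3),
            ~ closure (K z.1) z.2].

(* Circles of the family need not be contained in U. The cone field K is a germ
   at P, and it may depend on the circle g. *)
Definition rich_family (R : realType) (U : set 'rV[R]_3)
    (Delta : set (set 'rV[R]_3)) : Prop :=
  (forall g, Delta g -> is_circle g) /\
  exists Gamma : set (set 'rV[R]_3),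
    [/\ Gamma `<=` Delta,
        forall P, U P -> exists g, Gamma g /\ g P
      & forall g P, Gamma g -> U P -> g P ->
          exists (V : set 'rV[R]_3) (K : 'rV[R]_3 -> set 'rV[R]_3),
            [/\ [/\ open V, V P & V `<=` U],
                continuous_cone_field V K,
                forall v, tangent_direction g P v -> K P v
              & forall Q v, V Q -> K Q v ->
                  exists g', [/\ Gamma g', g' Q & tangent_direction g' Q v]]].

(* Class C^n on an open set U; C^(n+1) means differentiable with all directional
   derivatives of class C^n. *)
Fixpoint class_C (R : realType) (p q : nat) (n : nat) (U : set 'rV[R]_p.+1)
    (f : 'rV[R]_p.+1 -> 'rV[R]_q.+1) {struct n} : Prop :=
  match n with
  | 0%N => forall x, U x -> {for x, continuous f}
  | m.+1 => (forall x, U x -> differentiable f x) /\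
            (forall v, class_C m U (fun x => 'D_v f x))
  end.

Definition smooth_on (R : realType) (p q : nat) (U : set 'rV[R]_p.+1)
    (f : 'rV[R]_p.+1 -> 'rV[R]_q.+1) : Prop := forall n, class_C n U f.

Definition diffeo_onto_image (R : realType) (p : nat) (U : set 'rV[R]_p.+1)
    (f : 'rV[R]_p.+1 -> 'rV[R]_p.+1) : Prop :=
  [/\ open U, open (f @` U), smooth_on U f
    & exists g : 'rV[R]_p.+1 -> 'rV[R]_p.+1,
        smooth_on (f @` U) g /\ forall x, U x -> g (f x) = x].

Definition rectifiable_near (R : realType) (P : 'rV[R]_3)
    (Delta : set (set 'rV[R]_3)) : Prop :=
  exists (V : set 'rV[R]_3) (f : 'rV[R]_3 -> 'rV[R]_3),
    [/\ open V, V P, diffeo_onto_image V f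
      & forall g, Delta g -> exists l, is_line l /\ f @` (g `&` V) `<=` l].

(* RP^3 is the set of one-dimensional subspaces of R^4; a projective line is a
   two-dimensional subspace, incident to the points it contains. *)
Definition rp3_point (R : realType) (p : {vspace 'rV[R]_4}) : Prop :=
  \dim p = 1%N.

Definition rp3_line (R : realType) (l : {vspace 'rV[R]_4}) : Prop :=
  \dim l = 2%N.

(* The j-th affine chart sends [v_0 : v_1 : v_2 : v_3] to (v_i / v_j)_(i != j);
   this does not depend on the representative v, here vpick p. *)
Definition chart_dom (R : realType) (j : 'I_4) (p : {vspace 'rV[R]_4}) : Prop :=
  rp3_point p /\ vpick p 0 j != 0.

Definition chart (R : realType) (j : 'I_4) (p : {vspace 'rV[R]_4}) : 'rV[R]_3 :=
  \row_(i < 3) (vpick p 0 (lift j i) / vpick p 0 j).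

(* F is a diffeomorphism of W onto an open subset of RP^3: it is injective and,
   locally, a diffeomorphism in some affine chart. *)
Definition rp3_diffeo_onto_image (R : realType) (W : set 'rV[R]_3)
    (F : 'rV[R]_3 -> {vspace 'rV[R]_4}) : Prop :=
  [/\ open W,
      forall X, W X -> rp3_point (F X),
      forall X Y, W X -> W Y -> F X = F Y -> X = Y
    & forall X, W X -> exists (j : 'I_4) (W' : set 'rV[R]_3),
        [/\ W' X, W' `<=` W, forall Y, W' Y -> chart_dom j (F Y)
          & diffeo_onto_image W' (fun Y => chart j (F Y))]].

(* The Jacobian determinant is taken in every affine chart around F X. *)
Definition nonzero_jacobian (R : realType) (F : 'rV[R]_3 -> {vspace 'rV[R]_4})
    (X : 'rV[R]_3) : Prop :=
  forall j : 'I_4, chart_dom j (F X) ->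
    \det (jacobian (fun Y => chart j (F Y)) X) != 0.

Definition sphere_map (R : realType) (a b c d e : 'I_4 -> R) (X : 'rV[R]_3) :
    {vspace 'rV[R]_4} :=
  let x := X 0 0 in let y := X 0 1 in let z := X 0 2 in
  let S : 'rV[R]_4 := \row_(i < 4)
    (a i * (x ^+ 2 + y ^+ 2 + z ^+ 2) + b i * x + c i * y + d i * z + e i) in
  <[S]>%VS.

(* Main.v *)
Require Import Defs.
From mathcomp Require Import all_boot all_order all_algebra.
From mathcomp Require Import all_classical all_reals all_analysis.
From mathcomp Require Import complex ring lra.
Import Order.TTheory GRing.Theory Num.Theory.
Import numFieldNormedType.Exports.
Local Open Scope classical_set_scope.
Local Open Scope ring_scope.
Set Implicit Arguments.
Unset Strict Implicit.
Unset Printing Implicit Defensive.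

(** Let f rectify the family near P and let G be its inverse.

    A point X of R^3 is lifted to (|X-P|^2, X-P, 1) in R^5. The lift turns a
    circle into the set of points whose image lies in a three-dimensional
    subspace, that is, in a plane of RP^4, and a map given by four functions S_i
    of the required kind is the lift followed by a linear map from R^5 to R^4.
    If this linear map is the projection of RP^4 from a point O, then the planes
    through O are the inverse images of the lines of RP^3. So it suffices to
    find a point O that lies in the planes of all the circles of the family that
    pass near P.

    The first step is infinitesimal. Through a point Q near P passes a circle of
    the family in each direction u of an open cone, and G parametrizes it by a
    straight line. Its derivatives at Q of orders 1 to 4 are u, B(u), C(u) and
    D(u), where B, C and D are polynomial in u. Staying on a circle imposes
    polynomial identities on these vectors ([circle_jet]). Being true on an open
    cone, they are true for complex u ([polynomial_fun_complexify]), and at the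
    isotropic vectors, those with u.u = 0, they force B(u) to be proportional to
    u ([isotropic_jet]). Therefore B(u) = lam(u) u + (u.u) w with lam linear and
    w constant ([quadratic_map_of_isotropic]). Now B(u) determines the curvature
    of the circle, and a common w means that all the circles of the family
    through Q have in their planes one and the same line L_Q of RP^4
    ([pole_of_directions], [pole_line_sub_circle]).

    The second step is synthetic. If two points are joined by a circle of the
    family, then their lines L both lie in the plane of that circle, hence meet.
    Near P one can choose two points A and B which are joined to each other and
    to every point X of a neighbourhood of P, with X outside the circle through
    A and B ([joining]). The three lines L_A, L_B and L_X meet pairwise and are
    not coplanar, so they are concurrent ([concurrent_lines]), which means that
    the point O common to L_A and L_B lies on all the lines L_X
    ([projection_center]).

    It remains to see that the projection from O is a diffeomorphism near P.
    After rescaling, O is (2, w, alpha), and with Y = X - P the projection is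
    [Y - |Y|^2 w / 2 : 1 - alpha |Y|^2 / 2]. It is inverted by the quadratic
    formula, which gives a smooth inverse ([sphere_chart_diffeo]).

    For the converse, the composition of Phi with an affine chart of RP^3 is a
    rectifying diffeomorphism ([rectifiable_of_sphere_map]). *)


(** * Polynomial functions and their complexification *)

Section Complexification.
Local Open Scope complex_scope.

(** Described by closure properties: all that is used of a polynomial function is
    that its restriction to a line is a univariate polynomial. *)
Inductive polynomial_fun (C : pzRingType) (I : Type) : ((I -> C) -> C) -> Prop :=
| PolyCst c : polynomial_fun (fun _ => c)
| PolyVar i : polynomial_fun (fun u => u i)
| PolyAdd F G : polynomial_fun F -> polynomial_fun G ->
    polynomial_fun (fun u => F u + G u)
| PolyMul F G : polynomial_fun F -> polynomial_fun G ->
    polynomial_fun (fun u => F u * G u).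

Lemma polynomial_funN (C : pzRingType) I (F : (I -> C) -> C) :
  polynomial_fun F -> polynomial_fun (fun u => - F u).
Proof.
move=> hF; have -> : (fun u => - F u) = (fun u => -1 * F u).
  by apply/funext => u; rewrite mulN1r.
exact: PolyMul (PolyCst _ _) hF.
Qed.

Lemma polynomial_fun_sum (C : pzRingType) I n (F : 'I_n -> (I -> C) -> C) :
  (forall i, polynomial_fun (F i)) -> polynomial_fun (fun u => \sum_(i < n) F i u).
Proof.
elim: n F => [|n IHn] F hF.
  have -> : (fun u => \sum_(i < 0) F i u) = (fun _ => 0).
    by apply/funext => u; rewrite big_ord0.
  exact: PolyCst.
have -> : (fun u => \sum_(i < n.+1) F i u) =
    (fun u => \sum_(i < n) F (lift ord0 i) u + F ord0 u).
  by apply/funext => u; rewrite big_ord_recl addrC.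
by apply: PolyAdd (hF _); apply: IHn => i; apply: hF.
Qed.

Lemma polynomial_fun_line (C : comNzRingType) I (F : (I -> C) -> C) (a b : I -> C) :
  polynomial_fun F -> exists p : {poly C}, forall s, F (fun i => a i + s * b i) = p.[s].
Proof.
elim=> {F} [c|i|F G _ [p hp] _ [q hq]|F G _ [p hp] _ [q hq]].
- by exists c%:P => s; rewrite hornerC.
- by exists ((a i)%:P + 'X * (b i)%:P) => s; rewrite !hornerE.
- by exists (p + q) => s; rewrite hp hq hornerD.
- by exists (p * q) => s; rewrite hp hq hornerM.
Qed.


Lemma poly_real_interval_eq0 (R : rcfType) (p : {poly R[i]}) (e : R) : 0 < e ->
  (forall s : R, `|s| < e -> p.[s%:C] = 0) -> p = 0.
Proof.
move=> e0 hp; apply/eqP; apply/negPn/negP => p0.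
pose r (k : nat) : R := e / k.+2%:R.
have rinj : injective r.
  move=> k l /(mulfI (lt0r_neq0 e0)) /invr_inj /eqP.
  by rewrite eqr_nat => /eqP [].
pose rs := [seq (r k)%:C | k <- iota 0 (size p)].
have /(max_poly_roots p0) : all (root p) rs.
  apply/allP => _ /mapP[k _ ->]; apply/rootP/hp.
  rewrite ger0_norm ?divr_ge0 ?(ltW e0)//.
  by rewrite ltr_pdivrMr// ltr_pMr// ltr1n.
rewrite map_inj_uniq ?iota_uniq; last by move=> k l [] /rinj.
by move=> /(_ isT); rewrite size_map size_iota ltnn.
Qed.

(** On the points v0 + s (x - v0) + t y, the function is a polynomial in s and
    a polynomial in t, zero when s and t are real and small. The identity theorem
    for polynomials frees first s, with t real, and then t; the point x + i y is
    the case s = 1, t = i. *)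
Lemma polynomial_fun_complexify (R : realType) (F : ('I_3 -> R[i]) -> R[i])
    (v0 : 'rV[R]_3) (e : R) : 0 < e -> polynomial_fun F ->
  (forall u : 'rV[R]_3, `|u - v0| < e -> F (fun i => (u 0 i)%:C) = 0) ->
  forall x y : 'rV[R]_3, F (fun i => x 0 i +i* y 0 i) = 0.
Proof.
move=> e0 pF F0 x y.
pose M := `|x - v0| + `|y|.
have M0 : 0 <= M by rewrite addr_ge0.
pose d := e / (M + 1).
have d0 : 0 < d by rewrite divr_gt0// ltr_wpDl.
have small (s t : R) : `|s| < d -> `|t| < d ->
    F (fun i => ((v0 0 i)%:C + t%:C * (y 0 i)%:C) + s%:C * ((x - v0) 0 i)%:C) = 0.
  move=> sd td; pose u := v0 + t *: y + s *: (x - v0).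
  rewrite -[RHS](F0 u).
    by congr F; apply/funext => i; rewrite !mxE !(rmorphD, rmorphM)/=.
  have -> : u - v0 = s *: (x - v0) + t *: y by rewrite /u [LHS]addrC -[v0 + _ + _]addrA addKr [RHS]addrC.
  rewrite (le_lt_trans (ler_normD _ _))// !normrZ.
  have : `|s| * `|x - v0| + `|t| * `|y| <= d * M.
    by rewrite mulrDr lerD// ler_wpM2r// ltW.
  move/le_lt_trans; apply; rewrite /d mulrAC ltr_pdivrMr; last by rewrite ltr_wpDl.
  by rewrite ltr_pM2l// ltrDl.
have step (t : R) (s : R[i]) : `|t| < d ->
    F (fun i => ((v0 0 i)%:C + s * ((x - v0) 0 i)%:C) + t%:C * (y 0 i)%:C) = 0.
  move=> td; have [p hp] := polynomial_fun_line (fun i => (v0 0 i)%:C + t%:C * (y 0 i)%:C)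
    (fun i => ((x - v0) 0 i)%:C) pF.
  have p0 : p = 0 by apply: (poly_real_interval_eq0 d0) => s' s'd; rewrite -hp small.
  transitivity (p.[s]); last by rewrite p0 horner0.
  by rewrite -hp; congr F; apply/funext => i; rewrite addrAC.
have [p hp] := polynomial_fun_line (fun i => (v0 0 i)%:C + 1 * ((x - v0) 0 i)%:C)
    (fun i => (y 0 i)%:C) pF.
have p0 : p = 0 by apply: (poly_real_interval_eq0 d0) => s' s'd; rewrite -hp step.
transitivity (p.['i]); last by rewrite p0 horner0.
rewrite -hp; congr F; apply/funext => i; rewrite mul1r !mxE.
by simpc; congr (_ +i* _); ring.
Qed.

End Complexification.


(** * Jets at isotropic vectors *)

(** The triple enumerates the index set. Stated through sums over an arbitrary
    monoid, it lets one computation serve for the three coordinate planes, and for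
    real as well as complex coordinates. *)
Definition indices3 (p q r : 'I_3) : Prop :=
  forall (V : nmodType) (F : 'I_3 -> V), \sum_i F i = F p + F q + F r.

Lemma indices3_cycle : [/\ indices3 0 1 2, indices3 1 2 0 & indices3 2 0 1].
Proof.
have h : indices3 0 1 2.
  move=> V F; rewrite !big_ord_recr big_ord0/= add0r.
  by congr (F _ + F _ + F _); apply/val_inj.
split => // V F; rewrite h; first by rewrite -addrA addrC.
by rewrite addrC addrA.
Qed.

Lemma indices3_neq p q r : indices3 p q r ->
  [/\ (p == q) = false, (p == r) = false & (q == r) = false].
Proof.
move=> s; have one x : \sum_(l < 3) ((l == x) : nat) = 1%N.
  by rewrite (bigD1 x)//= big1 ?eqxx ?addr0// => l /negPf ->.
move: (s nat (fun l => (l == p) : nat)) (s nat (fun l => (l == q) : nat)).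
rewrite !one !eqxx (eq_sym q p) (eq_sym r p) (eq_sym r q).
by case: (p == q); case: (p == r); case: (q == r).
Qed.

(** Since u.u = 0, the first identity says that (u.B) B is proportional to u.
    Suppose that B itself is not. Then B is orthogonal to u, the vanishing
    determinant puts C in the plane of u and B, so that C is orthogonal to u too,
    and the second identity makes B isotropic. But in dimension 3 an isotropic
    vector orthogonal to the isotropic vector u is a multiple of u. *)
Lemma isotropic_jet (F : numFieldType) (i : F) (p q r : 'I_3)
    (u B C D : 'I_3 -> F) :
  i ^+ 2 = -1 -> indices3 p q r -> u p = 1 -> u q = i -> u r = 0 ->
  let Q := \sum_k u k * u k in let uB := \sum_k u k * B k in
  let uC := \sum_k u k * C k in let BB := \sum_k B k * B k in
  (forall k l, u k * (Q * C l - 3 * uB * B l) = u l * (Q * C k - 3 * uB * B k)) ->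
  (forall k l, u k * (Q * D l - (4 * uC + 3 * BB) * B l) =
               u l * (Q * D k - (4 * uC + 3 * BB) * B k)) ->
  u p * (B q * C r - B r * C q) + u q * (B r * C p - B p * C r)
    + u r * (B p * C q - B q * C p) = 0 ->
  B r = 0 /\ B q = i * B p.
Proof.
move=> i2 s3 up uq ur Q uB uC BB h1 h2 h3.
have Q0 : Q = 0.
  by rewrite /Q s3 up uq ur; transitivity (1 + i ^+ 2); [ring | rewrite i2 subrr].
have uBE : uB = B p + i * B q by rewrite /uB s3 up uq ur; ring.
have uCE : uC = C p + i * C q by rewrite /uC s3 up uq ur; ring.
have n3 : (3 : F) != 0 by rewrite pnatr_eq0.
have iK (x y : F) : x + i * y = 0 -> y = i * x.
  move/(congr1 ( *%R i)); rewrite mulr0 mulrDr mulrA -expr2 i2 mulN1r => /subr0_eq.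
  by move->.
have Br : B r = 0.
  apply/eqP/negPn/negP => Br0.
  have uB0 : uB = 0.
    move: (h1 p r); rewrite Q0 up ur mul0r mul1r mul0r sub0r => /eqP.
    by rewrite oppr_eq0 !mulf_eq0 (negPf n3) (negPf Br0) orbF => /eqP.
  have Bq : B q = i * B p by apply: iK; rewrite -uBE.
  have Cq : C q = i * C p.
    move: h3; rewrite up uq ur Bq.
    have -> : 1 * (i * B p * C r - B r * C q) + i * (B r * C p - B p * C r) +
      0 * (B p * C q - i * B p * C p) = - (B r * (C q - i * C p)) by ring.
    by move/eqP; rewrite oppr_eq0 mulf_eq0 (negPf Br0) => /eqP/subr0_eq.
  have uC0 : uC = 0.
    by rewrite uCE Cq mulrA -expr2 i2 mulN1r subrr.
  move: (h2 p r); rewrite Q0 up ur mul0r mul1r mul0r sub0r uC0 mulr0 add0r => /eqP.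
  rewrite oppr_eq0 !mulf_eq0 (negPf n3) (negPf Br0) orbF /= /BB s3 Bq.
  have -> : B p * B p + i * B p * (i * B p) + B r * B r =
    (1 + i ^+ 2) * B p ^+ 2 + B r ^+ 2 by ring.
  by rewrite i2 subrr mul0r add0r sqrf_eq0 (negPf Br0).
split=> //; have [uB0|uB0] := eqVneq uB 0; first by apply: iK; rewrite -uBE.
move: (h1 p q); rewrite Q0 up uq !mul0r mul1r !sub0r mulrN => /oppr_inj.
by rewrite mulrCA => /(mulfI (mulf_neq0 n3 uB0)).
Qed.

Section QuadraticMap.
Local Open Scope complex_scope.
(** At u = e_p + i e_q, the real and imaginary parts of the proportionality give
    four linear relations between the coefficients; those for three pairs (p, q)
    determine the shape of the quadratic map. *)
Lemma quadratic_map_of_isotropic (R : realType) (b : 'I_3 -> 'I_3 -> 'rV[R]_3) :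
  (forall p q r, indices3 p q r ->
     let B (l : 'I_3) : R[i] :=
       \sum_k ((k == p)%:R +i* (k == q)%:R) *
         \sum_j ((j == p)%:R +i* (j == q)%:R) * (b k j 0 l)%:C in
     B r = 0 /\ B q = 'i * B p) ->
  exists lam w : 'rV[R]_3, forall u : 'rV[R]_3,
    \sum_k u 0 k *: (\sum_j u 0 j *: b k j) = dot lam u *: u + dot u u *: w.
Proof.
move=> H; have [s0 s1 s2] := indices3_cycle.
have E p q r : indices3 p q r ->
  [/\ b p p 0 r = b q q 0 r, b p q 0 r = - b q p 0 r,
      b p p 0 q - b q q 0 q = - (b p q 0 p + b q p 0 p) &
      b p q 0 q + b q p 0 q = b p p 0 p - b q q 0 p].
  move=> s; have [] := H _ _ _ s.
  have [pq pr qr] := indices3_neq s.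
  rewrite !s !eqxx (eq_sym q p) (eq_sym r p) (eq_sym r q) pq pr qr.
  simpc; rewrite ?mulr0n ?mulr1n.
  move=> /= [] h1 h2 [] h3 h4; split; lra.
have [a1 a2 a3 a4] := E _ _ _ s0.
have [b1 b2 b3 b4] := E _ _ _ s1.
have [c1 c2 c3 c4] := E _ _ _ s2.
(* w 0 l is the coefficient of the square of any coordinate other than l in the
   l-th component; the index l + 1, modulo 3, is such a coordinate. *)
pose w := \row_l (b (l + 1) (l + 1) 0 l).
exists (\row_l (b l l 0 l - w 0 l)), w => u.
apply/rowP => l; rewrite !summxE !mxE /dot !s0 !mxE.
have [-> -> ->] : [/\ (0 + 1 : 'I_3) = 1, (1 + 1 : 'I_3) = 2 & (2 + 1 : 'I_3) = 0].
  by split; apply/val_inj.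
have {}a4 : b 0 1 0 1 = b 0 0 0 0 - b 1 1 0 0 - b 1 0 0 1 by rewrite -a4 addrK.
have {}b4 : b 1 2 0 2 = b 1 1 0 1 - b 2 2 0 1 - b 2 1 0 2 by rewrite -b4 addrK.
have {}c4 : b 2 0 0 0 = b 2 2 0 2 - b 0 0 0 2 - b 0 2 0 0 by rewrite -c4 addrK.
have {}a3 : b 0 1 0 0 = b 1 1 0 1 - b 0 0 0 1 - b 1 0 0 0 by lra.
have {}b3 : b 1 2 0 1 = b 2 2 0 2 - b 1 1 0 2 - b 2 1 0 1 by lra.
have {}c3 : b 2 0 0 2 = b 0 0 0 0 - b 2 2 0 0 - b 0 2 0 2 by lra.
have [->|[->|->]] : l = 0 \/ l = 1 \/ l = 2.
  by case: l => -[|[|[|//]]] h; [left|right; left|right; right]; apply/val_inj.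
- have -> : (0 + 1 : 'I_3) = 1 by apply/val_inj.
  by rewrite a3 b2 c4 a1 b1 c1; ring.
- have -> : (1 + 1 : 'I_3) = 2 by apply/val_inj.
  by rewrite a4 b3 c2 b1 c1 a1; ring.
- have -> : (2 + 1 : 'I_3) = 0 by apply/val_inj.
  by rewrite a2 b4 c3 a1 b1 c1; ring.
Qed.

End QuadraticMap.
(** * Euclidean geometry of R^3 *)

Section Dot.
Variables (R : realType).
Implicit Types u v w : 'rV[R]_3.

Lemma dotC n (u v : 'rV[R]_n) : dot u v = dot v u.
Proof. by apply: eq_bigr => i _; rewrite mulrC. Qed.

Lemma dotDl n (u v w : 'rV[R]_n) : dot (u + v) w = dot u w + dot v w.
Proof. by rewrite -big_split; apply: eq_bigr => i _; rewrite mxE mulrDl. Qed.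

Lemma dotZl n t (u w : 'rV[R]_n) : dot (t *: u) w = t * dot u w.
Proof. by rewrite /dot mulr_sumr; apply: eq_bigr => i _; rewrite mxE mulrA. Qed.

Lemma dotNl n (u w : 'rV[R]_n) : dot (- u) w = - dot u w.
Proof. by rewrite -scaleN1r dotZl mulN1r. Qed.

Lemma dotDr n (u v w : 'rV[R]_n) : dot w (u + v) = dot w u + dot w v.
Proof. by rewrite dotC dotDl !(dotC w). Qed.

Lemma dotZr n t (u w : 'rV[R]_n) : dot w (t *: u) = t * dot w u.
Proof. by rewrite dotC dotZl (dotC w). Qed.

Lemma dotNr n (u w : 'rV[R]_n) : dot w (- u) = - dot w u.
Proof. by rewrite dotC dotNl (dotC w). Qed.

Lemma dot0l n (w : 'rV[R]_n) : dot 0 w = 0.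
Proof. by rewrite -(scale0r 0) dotZl mul0r. Qed.

Lemma dot0r n (w : 'rV[R]_n) : dot w 0 = 0.
Proof. by rewrite dotC dot0l. Qed.

Lemma dot_ge0 n (u : 'rV[R]_n) : 0 <= dot u u.
Proof. by apply: sumr_ge0 => i _; rewrite -expr2 sqr_ge0. Qed.

Lemma dot_eq0 n (u : 'rV[R]_n) : (dot u u == 0) = (u == 0).
Proof.
apply/idP/eqP => [|->]; last by rewrite dot0l.
rewrite psumr_eq0 => [/allP h|i _]; last by rewrite -expr2 sqr_ge0.
apply/rowP => i; rewrite mxE; apply/eqP.
by have := h i; rewrite mem_index_enum => /(_ isT); rewrite mulf_eq0 orbb.
Qed.

Lemma dot_gt0 n (u : 'rV[R]_n) : u != 0 -> 0 < dot u u.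
Proof. by move=> u0; rewrite lt_def dot_eq0 u0 dot_ge0. Qed.

Definition dotE := (dotDl, dotDr, dotZl, dotZr, dotNl, dotNr).

Lemma dot3 u v : dot u v = u 0 0 * v 0 0 + u 0 1 * v 0 1 + u 0 2 * v 0 2.
Proof. by rewrite /dot; case: indices3_cycle => ->. Qed.

Lemma coordD n (u v : 'rV[R]_n) l : (u + v) 0 l = u 0 l + v 0 l.
Proof. by rewrite mxE. Qed.

Lemma coordN n (u : 'rV[R]_n) l : (- u) 0 l = - u 0 l.
Proof. by rewrite mxE. Qed.

Lemma coordZ n t (u : 'rV[R]_n) l : (t *: u) 0 l = t * u 0 l.
Proof. by rewrite mxE. Qed.

Definition coordE := (coordD, coordN, coordZ).

Lemma ord3P (i : 'I_3) : [\/ i = 0, i = 1 | i = 2].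
Proof.
by case: i => -[|[|[|//]]] h; [constructor 1|constructor 2|constructor 3]; apply/val_inj.
Qed.

Definition cross u v : 'rV[R]_3 :=
  \row_i (u 0 (i + 1) * v 0 (i + 2) - u 0 (i + 2) * v 0 (i + 1)).

Lemma crossE u v : [/\ cross u v 0 0 = u 0 1 * v 0 2 - u 0 2 * v 0 1,
  cross u v 0 1 = u 0 2 * v 0 0 - u 0 0 * v 0 2 &
  cross u v 0 2 = u 0 0 * v 0 1 - u 0 1 * v 0 0].
Proof.
by split; rewrite mxE; congr (_ * _ - _ * _); congr fun_of_matrix; apply/val_inj.
Qed.

Lemma cross_eq0 u v : cross u v = 0 -> forall k l, u 0 k * v 0 l = u 0 l * v 0 k.
Proof.
move=> h k l; have [c0 c1 c2] := crossE u v.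
move: c0 c1 c2; rewrite h !mxE => c0 c1 c2.
case: (ord3P k) => ->; case: (ord3P l) => -> //; lra.
Qed.

Lemma dot_crossl u v : dot u (cross u v) = 0.
Proof. by rewrite dot3; case: (crossE u v) => -> -> ->; ring. Qed.

Lemma dot_crossr u v : dot v (cross u v) = 0.
Proof. by rewrite dot3; case: (crossE u v) => -> -> ->; ring. Qed.

Lemma dot_cross_cross u v :
  dot (cross u v) (cross u v) = dot u u * dot v v - dot u v ^+ 2.
Proof. by rewrite !dot3; case: (crossE u v) => -> -> ->; ring. Qed.

(** With z = u x v, the triple product formula gives z x m = 0, and applied again
    it expands 0 = z x (z x m) as (z.m) z - (z.z) m. *)
Lemma cross_collinear m u v : dot m u = 0 -> dot m v = 0 ->
  dot (cross u v) (cross u v) *: m = dot m (cross u v) *: cross u v.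
Proof.
move=> hu hv; apply/eqP; rewrite -subr_eq0; apply/eqP.
have -> : dot (cross u v) (cross u v) *: m - dot m (cross u v) *: cross u v =
    dot m v *: cross (cross u v) u - dot m u *: cross (cross u v) v.
  have [c0 c1 c2] := crossE u v.
  have [d0 d1 d2] := crossE (cross u v) u.
  have [e0 e1 e2] := crossE (cross u v) v.
  apply/rowP => l; rewrite !(dot3, coordE).
  case: (ord3P l) => ->.
  - by rewrite d0 e0 c0 c1 c2; ring.
  - by rewrite d1 e1 c0 c1 c2; ring.
  - by rewrite d2 e2 c0 c1 c2; ring.
by rewrite hu hv !scale0r subrr.
Qed.

(** If u x v were nonzero, m and n would both be multiples of it, which is
    incompatible with their being orthogonal to each other. *)
Lemma orthogonal_frame_collinear m n u v : m != 0 -> n != 0 -> dot m n = 0 ->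
  dot m u = 0 -> dot m v = 0 -> dot n u = 0 -> dot n v = 0 ->
  forall k l, u 0 k * v 0 l = u 0 l * v 0 k.
Proof.
move=> m0 n0 mn mu mv nu nv; apply: cross_eq0; apply/eqP; set z := cross u v.
have hm : dot z z *: m = dot m z *: z by apply: cross_collinear.
have hn : dot z z *: n = dot n z *: z by apply: cross_collinear.
apply/negPn/negP; rewrite -dot_eq0 => z0.
have : dot (dot z z *: m) (dot z z *: n) = 0 by rewrite dotZl dotZr mn !mulr0.
rewrite hm hn dotZl dotZr => /eqP; rewrite !mulf_eq0 (negPf z0) orbF.
case/orP => /eqP h.
- by move/eqP: hm; rewrite h scale0r scaler_eq0 (negPf z0) (negPf m0).
- by move/eqP: hn; rewrite h scale0r scaler_eq0 (negPf z0) (negPf n0).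
Qed.

(** Here A, B, C and D are the first four derivatives of a motion along a circle,
    at a point from which m leads to the centre, and n is normal to the plane of the
    circle. In the first two identities the combinations of B with C and with D are
    chosen to be orthogonal to m; like A, they are then orthogonal to the frame
    (m, n). The third one holds since A, B and C lie in the plane of the circle. *)
Lemma circle_jet (m n A B C D : 'rV[R]_3) :
  m != 0 -> n != 0 -> dot m n = 0 ->
  dot n A = 0 -> dot n B = 0 -> dot n C = 0 -> dot n D = 0 ->
  dot m A = 0 -> dot m B = dot A A -> dot m C = 3 * dot A B ->
  dot m D = 4 * dot A C + 3 * dot B B ->
  [/\ forall k l, A 0 k * (dot A A *: C - (3 * dot A B) *: B) 0 l =
                  A 0 l * (dot A A *: C - (3 * dot A B) *: B) 0 k,
      forall k l, A 0 k * (dot A A *: D - (4 * dot A C + 3 * dot B B) *: B) 0 l =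
                  A 0 l * (dot A A *: D - (4 * dot A C + 3 * dot B B) *: B) 0 k
    & forall p q r, indices3 p q r ->
      A 0 p * (B 0 q * C 0 r - B 0 r * C 0 q) + A 0 q * (B 0 r * C 0 p - B 0 p * C 0 r)
      + A 0 r * (B 0 p * C 0 q - B 0 q * C 0 p) = 0].
Proof.
move=> m0 n0 mn nA nB nC nD mA mB mC mD; split.
- apply: (orthogonal_frame_collinear m0 n0 mn mA _ nA); rewrite !dotE ?nB ?nC ?mB ?mC; ring.
- apply: (orthogonal_frame_collinear m0 n0 mn mA _ nA); rewrite !dotE ?nB ?nD ?mB ?mD; ring.
- move=> p q r s; set d := (X in X = 0).
  have dE k : k \in [:: p; q; r] -> n 0 k * d = 0.
    move: nA nB nC; rewrite /dot !s => nA nB nC.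
    rewrite !inE => /or3P[]/eqP->; rewrite /d.
    + transitivity ((n 0 p * A 0 p + n 0 q * A 0 q + n 0 r * A 0 r) * (B 0 q * C 0 r - B 0 r * C 0 q)
       - (n 0 p * B 0 p + n 0 q * B 0 q + n 0 r * B 0 r) * (A 0 q * C 0 r - A 0 r * C 0 q)
       + (n 0 p * C 0 p + n 0 q * C 0 q + n 0 r * C 0 r) * (A 0 q * B 0 r - A 0 r * B 0 q)); first by ring.
      by rewrite nA nB nC; ring.
    + transitivity ((n 0 p * A 0 p + n 0 q * A 0 q + n 0 r * A 0 r) * (B 0 r * C 0 p - B 0 p * C 0 r)
       - (n 0 p * B 0 p + n 0 q * B 0 q + n 0 r * B 0 r) * (A 0 r * C 0 p - A 0 p * C 0 r)
       + (n 0 p * C 0 p + n 0 q * C 0 q + n 0 r * C 0 r) * (A 0 r * B 0 p - A 0 p * B 0 r)); first by ring.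
      by rewrite nA nB nC; ring.
    + transitivity ((n 0 p * A 0 p + n 0 q * A 0 q + n 0 r * A 0 r) * (B 0 p * C 0 q - B 0 q * C 0 p)
       - (n 0 p * B 0 p + n 0 q * B 0 q + n 0 r * B 0 r) * (A 0 p * C 0 q - A 0 q * C 0 p)
       + (n 0 p * C 0 p + n 0 q * C 0 q + n 0 r * C 0 r) * (A 0 p * B 0 q - A 0 q * B 0 p)); first by ring.
      by rewrite nA nB nC; ring.
  apply/eqP/negPn/negP => d0.
  have n00 k : k \in [:: p; q; r] -> n 0 k = 0.
    by move/dE/eqP; rewrite mulf_eq0 (negPf d0) orbF => /eqP.
  move: n0; rewrite -dot_eq0 /dot s !n00 ?inE ?eqxx ?orbT//.
  by rewrite !mulr0 !addr0 eqxx.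
Qed.
End Dot.
(** * Jets along a straight line *)

Section Jets.
Variables (R : realType).
Implicit Types (f : 'rV[R]_3 -> 'rV[R]_3) (e : 'I_3 -> 'rV[R]_3) (u v y : 'rV[R]_3).

(** The k-th derivative of f at y along the vector \sum_i u_i e_i, expanded into
    partial derivatives so as to be visibly a polynomial in the coordinates of u.
    The same polynomial, at complex values of u, is [cjet]. *)
Fixpoint jet (k : nat) e f u y : 'rV[R]_3 :=
  if k is k'.+1 then \sum_i u 0 i *: jet k' e (fun x => 'D_(e i) f x) u y else f y.

Fixpoint cjet (k : nat) e f (u : 'I_3 -> R[i]) y l : R[i] :=
  if k is k'.+1 then \sum_i u i * cjet k' e (fun x => 'D_(e i) f x) u y l
  else (f y 0 l)%:C%C.

Lemma cjet_real k e f u y l :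
  cjet k e f (fun i => (u 0 i)%:C%C) y l = (jet k e f u y 0 l)%:C%C.
Proof.
elim: k f => [//|k IHk] f /=.
rewrite summxE rmorph_sum; apply: eq_bigr => i _.
by rewrite IHk mxE rmorphM.
Qed.

Lemma polynomial_cjet k e f y l : polynomial_fun (fun z : 'I_3 -> R[i] => cjet k e f z y l).
Proof.
elim: k f => [f|k IHk f] /=; first exact: PolyCst.
apply: polynomial_fun_sum => i; apply: PolyMul; last exact: IHk.
exact: (PolyVar _ i).
Qed.

Lemma derive_comb f y u e : differentiable f y ->
  'D_(\sum_i u 0 i *: e i) f y = \sum_i u 0 i *: 'D_(e i) f y.
Proof.
move=> df; rewrite deriveE// linear_sum.
by apply: eq_bigr => i _; rewrite linearZ/= deriveE.
Qed.

Lemma is_derive_line (V W : normedModType R) (h : V -> W) (a b : V) (t : R) :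
  differentiable h (a + t *: b) ->
  is_derive t 1 (fun s => h (a + s *: b)) ('D_b h (a + t *: b)).
Proof.
move=> df; have E (s : R) : h (a + (s *: 1 + t) *: b) = h (s *: b + (a + t *: b)).
  by congr h; rewrite [s *: 1]mulr1 scalerDl addrCA.
have dv : derivable h (a + t *: b) b by exact: diff_derivable.
split; first by move: dv; rewrite /derivable; under eq_fun do rewrite /= -E.
by rewrite /derive; under eq_fun do rewrite /= E.
Qed.

(** By induction on k for all f at once, since the operator d/dt commutes with the
    outer sums and reaches the innermost partial derivatives of f. *)
Lemma is_derive_jet k e f u y (t : R) (O : set 'rV[R]_3) :
  let v := \sum_i u 0 i *: e i in
  class_C k.+1 O f -> O (y + t *: v) ->
  is_derive t 1 (fun s => jet k e f u (y + s *: v)) (jet k.+1 e f u (y + t *: v)).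
Proof.
move=> v; elim: k f => [|k IHk] f [df cf] Ot.
  have := is_derive_line (df _ Ot); rewrite derive_comb//=.
  exact: df.
rewrite [X in is_derive _ _ X _](_ : _ = \sum_i (fun s => u 0 i *: jet k e (fun x => 'D_(e i) f x) u (y + s *: v))); last first.
  by apply/funext => s; rewrite fct_sumE.
apply: is_derive_sum => i; apply: is_deriveZ.
exact: IHk.
Qed.

End Jets.

(** * Motions along a circle *)

Section CircleCalculus.
Variable R : realType.

Lemma is_derive_coord (V : normedModType R) n (F : V -> 'rV[R]_n) (x v : V) dF i :
  is_derive x v F dF -> is_derive x v (fun t => F t 0 i) (dF 0 i).
Proof.
move=> [dF1 <-]; split; first exact: (derivable_mxP F x v).1.
by rewrite derive_mx// mxE.
Qed.

Lemma is_derive_dot (V : normedModType R) n (F G : V -> 'rV[R]_n) (x v : V) dF dG :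
  is_derive x v F dF -> is_derive x v G dG ->
  is_derive x v (fun t => dot (F t) (G t)) (dot dF (G x) + dot (F x) dG).
Proof.
move=> hF hG; rewrite /dot -big_split/=.
rewrite [X in is_derive _ _ X _](_ : _ = \sum_i ((fun t => F t 0 i) * (fun t => G t 0 i))); last first.
  by apply/funext => t; rewrite fct_sumE.
apply: is_derive_sum => i.
have hFi := is_derive_coord i hF; have hGi := is_derive_coord i hG.
apply: is_derive_eq; rewrite addrC; congr (_ + _).
exact: mulrC.
Qed.

Lemma is_derive_cst_eq0 (V W : normedModType R) (F : V -> W) (x v : V) a dF :
  (\forall y \near x, F y = a) -> is_derive x v F dF -> dF = 0.
Proof.
move=> Fa [_ <-]; rewrite (near_eq_derive _ (_ : \near x, F x = cst a x)) ?derive_cst//.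
Qed.

Lemma is_derive_scale (V : normedModType R) (a : R -> R) (w : V) (x da : R) :
  is_derive x 1 a da -> is_derive x 1 (fun t => a t *: w) (da *: w).
Proof.
move=> [da1 <-]; have ha : differentiable a x by exact/derivable1_diffP.
have haw : differentiable (fun t => a t *: w) x by exact: differentiableZl.
split; first exact/derivable1_diffP.
by rewrite !deriveE// diffZl.
Qed.

Lemma dot_continuous n (u : 'rV[R]_n) : continuous (fun x => dot x u).
Proof.
rewrite /dot; apply: continuous_big => [|i _ x]; first exact: add_continuous.
by apply: continuousM; [exact: coord_continuous | exact: cst_continuous].
Qed.

Lemma sqdist_continuous n (c : 'rV[R]_n) : continuous (fun x : 'rV[R]_n => dot (x - c) (x - c)).
Proof.
rewrite /dot; apply: continuous_big => [|i _ x]; first exact: add_continuous.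
have h : (z - c) 0 i @[z --> x] --> (x - c) 0 i.
  under eq_fun do rewrite !mxE; rewrite !mxE.
  by apply: continuousB; [exact: coord_continuous | exact: cst_continuous].
exact: (cvgM h h).
Qed.

Lemma circle_closed (g : set 'rV[R]_3) : is_circle g -> closed g.
Proof.
move=> [c [n [r [n0 r0 ->]]]].
have -> : [set X | dot (X - c) n = 0 /\ dot (X - c) (X - c) = r ^+ 2] =
  (fun X => dot X n) @^-1` [set x | x = dot c n] `&`
  (fun X => dot (X - c) (X - c)) @^-1` [set x | x = r ^+ 2].
  apply/seteqP; split => X /= [h ->]; split => //.
    by move/eqP: h; rewrite !dotE subr_eq0 => /eqP.
  by rewrite !dotE h subrr.
apply: closedI; apply: closed_comp; try exact: closed_eq.
  by move=> x _; exact: dot_continuous.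
by move=> x _; exact: sqdist_continuous.
Qed.

Lemma circle_motion (g : set 'rV[R]_3) X : is_circle g -> g X ->
  exists (c dc : R -> 'rV[R]_3),
    [/\ c 0 = X, dc 0 != 0, forall t, g (c t) & forall t : R, is_derive t 1 c (dc t)].
Proof.
move=> [c [n [r [n0 r0 ->]]]] /= [Xn Xr].
have -> : X = c + (X - c) by rewrite addrC subrK.
move: (X - c) Xn Xr => m Xn Xr {X}.
have N0 : 0 < dot n n by exact: dot_gt0.
(* k is m after a quarter turn in the plane of the circle *)
set k := (Num.sqrt (dot n n))^-1 *: cross n m.
have km : dot k m = 0 by rewrite /k dotZl dotC dot_crossr mulr0.
have kn : dot k n = 0 by rewrite /k dotZl dotC dot_crossl mulr0.
have kk : dot k k = r ^+ 2.
  rewrite /k dotZl dotZr dot_cross_cross (dotC n m) Xn expr0n subr0 mulrA -expr2.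
  by rewrite exprVn sqr_sqrtr ?(ltW N0)// mulKf ?gt_eqF.
clearbody k.
exists (fun t => c + (cos t *: m + sin t *: k)), (fun t => - sin t *: m + cos t *: k); split.
- by rewrite cos0 sin0 scale1r scale0r addr0.
- rewrite sin0 cos0 oppr0 scale0r scale1r add0r -dot_eq0 kk.
  by rewrite sqrf_eq0 gt_eqF.
- move=> t /=; rewrite addrAC subrr add0r !dotE Xn kn (dotC m k) km Xr kk; split; first by ring.
  by have := cos2Dsin2 t => h; rewrite -[RHS]mul1r -h; ring.
- move=> t; have hm := is_derive_scale m (is_derive_cos t).
  have hk := is_derive_scale k (is_derive_sin t).
  by apply: is_derive_eq; rewrite add0r.
Qed.

(** Write h t = t g t with g continuous at 0 and g 0 = d: on each small interval
    around 0 the function h takes values of both signs. *)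
Lemma local_IVT (h : R -> R) (d : R) (A : set R) : h 0 = 0 ->
  (\forall t \near (0 : R), {for t, continuous h}) -> is_derive (0 : R) (1 : R) h d -> d != 0 ->
  (\forall t \near (0 : R), A t) ->
  \forall y \near (0 : R), exists2 t, A t & h t = y.
Proof.
move=> h0 hc /is_derive1_caratheodory[g [hg gc g0]] d0 At.
have gc0 : g t @[t --> (0 : R)] --> g 0 by exact: gc.
rewrite g0 in gc0.
have gd : \forall t \near (0 : R), 0 < g t * d.
  have cg : g t * d @[t --> (0 : R)] --> d * d.
    by apply: cvgM; [exact: gc0 | exact: cvg_cst].
  by apply: (cvgr_gt _ cg); rewrite -expr2 exprn_even_gt0.
have [e /= e0 he] : \forall t \near (0 : R), [/\ {for t, continuous h}, 0 < g t * d & A t].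
  by near=> t; split; near: t.
pose a := e / 2; have a0 : 0 < a by rewrite divr_gt0.
have small t : -a <= t <= a -> [/\ {for t, continuous h}, 0 < g t * d & A t].
  move=> ta; apply: he => /=; rewrite sub0r normrN.
  by rewrite (@le_lt_trans _ _ a)// ?ler_norml// /a ltr_pdivrMr// ltr_pMr// ltr1n.
have hE t : h t = g t * t by have := hg t; rewrite h0 !subr0.
have ha : 0 < h a * d.
  rewrite hE mulrAC mulr_gt0//; case: (small a) => //.
  by rewrite lexx andbT (le_trans _ (ltW a0))// oppr_le0 ltW.
have hNa : h (- a) * d < 0.
  rewrite hE mulrN mulNr oppr_lt0 mulrAC mulr_gt0//; case: (small (- a)) => //.
  by rewrite lexx (le_trans _ (ltW a0))// oppr_le0 ltW.
have mm : Num.min (h (- a)) (h a) < 0 < Num.max (h (- a)) (h a).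
  rewrite gt_min lt_max; case/orP: (lt_total d0) => d1.
  - by rewrite (nmulr_llt0 _ d1) in hNa; rewrite (nmulr_lgt0 _ d1) in ha; rewrite hNa ha orbT.
  - by rewrite (pmulr_llt0 _ d1) in hNa; rewrite (pmulr_lgt0 _ d1) in ha; rewrite hNa ha orbT.
case/andP: mm => m1 m2.
near=> y.
have [|||t] := @IVT R h (- a) a y.
- by rewrite ge0_cp // ltW.
- apply: continuous_in_subspaceT => t; rewrite inE/= in_itv/= => /small[].
  by [].
- apply/andP; split; apply/ltW; near: y; [exact: lt_nbhsr|exact: lt_nbhsl].
- by rewrite in_itv/= => /small[_ _ tA] <-; exists t.
Unshelve. all: by end_near. Qed.

Lemma derive_left_inverse (V W : normedModType R) (f : V -> W) (g : W -> V) (x u : V) :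
  differentiable f x -> differentiable g (f x) -> (\forall y \near x, g (f y) = y) ->
  'D_('D_u f x) g (f x) = u.
Proof.
move=> df dg gf; rewrite deriveE// deriveE//.
have gfu : 'D_u (g \o f) x = u.
  rewrite -[RHS](derive_id x u); apply: near_eq_derive.
  by apply: filterS gf => y.
rewrite -[RHS]gfu deriveE; last exact: differentiable_comp.
by rewrite (diff_comp df dg).
Qed.

End CircleCalculus.

Section CircleDerivatives.
Variable R : realType.

Lemma near_derive_eq0 (F dF : R -> R) (a : R) :
  (\forall t \near (0 : R), F t = a) ->
  (\forall t \near (0 : R), is_derive (t : R) (1 : R) F (dF t)) ->
  \forall t \near (0 : R), dF t = 0.
Proof.
move=> /near_join Fa; apply: filterS2 Fa => t Fa.
by move=> dFt; exact: (is_derive_cst_eq0 Fa dFt).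
Qed.

Lemma near_derive_dot (F G dF dG : R -> 'rV[R]_3) :
  (\forall t \near (0 : R), is_derive (t : R) (1 : R) F (dF t)) ->
  (\forall t \near (0 : R), is_derive (t : R) (1 : R) G (dG t)) ->
  \forall t \near (0 : R), is_derive (t : R) (1 : R) (fun s => dot (F s) (G s))
    (dot (dF t) (G t) + dot (F t) (dG t)).
Proof. by apply: filterS2 => t; exact: is_derive_dot. Qed.

Lemma near_deriveD (F G dF dG : R -> R) :
  (\forall t \near (0 : R), is_derive (t : R) (1 : R) F (dF t)) ->
  (\forall t \near (0 : R), is_derive (t : R) (1 : R) G (dG t)) ->
  \forall t \near (0 : R), is_derive (t : R) (1 : R) (fun s => F s + G s) (dF t + dG t).
Proof. by apply: filterS2 => t; exact: is_deriveD. Qed.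

Lemma is_derive_subr (F : R -> 'rV[R]_3) (c dF : 'rV[R]_3) (t : R) :
  is_derive (t : R) (1 : R) F dF -> is_derive (t : R) (1 : R) (fun s => F s - c) dF.
Proof.
move=> h; have : is_derive (t : R) (1 : R) (F - cst c) (dF - 0) by apply: is_deriveB.
by rewrite subr0.
Qed.

(** The equations n.(p - c) = 0 and |p - c|^2 = r^2 of the circle are
    differentiated four times. *)
Lemma circle_derivatives (p : nat -> R -> 'rV[R]_3) (c n : 'rV[R]_3) (r : R) :
  (forall k, (k < 4)%N -> \forall t \near (0 : R), is_derive (t : R) (1 : R) (p k) (p k.+1 t)) ->
  (\forall t \near (0 : R), dot (p 0%N t - c) n = 0) ->
  (\forall t \near (0 : R), dot (p 0%N t - c) (p 0%N t - c) = r ^+ 2) ->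
  let m := c - p 0%N 0 in let q k := p k (0 : R) in
  (dot n (q 1%N) = 0 /\ dot n (q 2%N) = 0 /\ dot n (q 3%N) = 0 /\ dot n (q 4%N) = 0) /\
  (dot m (q 1%N) = 0 /\ dot m (q 2%N) = dot (q 1%N) (q 1%N) /\
   dot m (q 3%N) = 3 * dot (q 1%N) (q 2%N) /\
   dot m (q 4%N) = 4 * dot (q 1%N) (q 3%N) + 3 * dot (q 2%N) (q 2%N)).
Proof.
move=> dp hn hr m q.
have d0 : \forall t \near (0 : R), is_derive (t : R) (1 : R) (fun s => p 0%N s - c) (p 1%N t).
  by apply: filterS (dp 0%N isT) => t; exact: is_derive_subr.
have [[d1 d2] d3] := (dp 1%N isT, dp 2%N isT, dp 3%N isT).
have step F dF (hF : \forall t \near (0 : R), is_derive (t : R) (1 : R) F (dF t)) :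
    (\forall t \near (0 : R), dot (F t) n = 0) ->
    (\forall t \near (0 : R), dot (dF t) n = 0).
  move=> h; apply: (near_derive_eq0 h); apply: filterS hF => t hF.
  have hc : is_derive (t : R) (1 : R) (fun=> n) 0 by exact: is_derive_cst.
  by have := is_derive_dot hF hc; rewrite dot0r addr0.
have n1 := step _ _ d0 hn; have n2 := step _ _ d1 n1.
have n3 := step _ _ d2 n2; have n4 := step _ _ d3 n3.
have e1 : \forall t \near (0 : R), dot (p 0%N t - c) (p 1%N t) = 0.
  have e0 := near_derive_eq0 hr (near_derive_dot d0 d0).
  apply: filterS e0 => t; rewrite (dotC (p 1%N t)) => h; lra.
have D01 := near_derive_dot d0 d1.
have e2 := near_derive_eq0 e1 D01.
have D11 := near_derive_dot d1 d1.
have D02 := near_derive_dot d0 d2.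
have e3 := near_derive_eq0 e2 (near_deriveD D11 D02).
have D12 := near_derive_dot d1 d2.
have D21 := near_derive_dot d2 d1.
have D03 := near_derive_dot d0 d3.
have A1 := near_deriveD D21 D12.
have A2 := near_deriveD D12 D03.
have e4 := near_derive_eq0 e3 (near_deriveD A1 A2).
have [[[{}n1 {}n2] {}n3] {}n4] := (nbhs_singleton n1, nbhs_singleton n2, nbhs_singleton n3, nbhs_singleton n4).
have [[[{}e1 {}e2] {}e3] {}e4] := (nbhs_singleton e1, nbhs_singleton e2, nbhs_singleton e3, nbhs_singleton e4).
have mE k : dot m (q k) = - dot (p 0%N 0 - c) (q k) by rewrite /m -opprB dotNl.
rewrite !mE !(dotC n); split; first by [].
move: e1 e2 e3 e4; rewrite -/(q 1%N) -/(q 2%N) -/(q 3%N) -/(q 4%N).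
rewrite (dotC (q 2%N) (q 1%N)) (dotC (q 3%N) (q 1%N)) => e1 e2 e3 e4.
by split; [|split; [|split]]; lra.
Qed.

End CircleDerivatives.

(** * Curves sent into lines by a diffeomorphism *)

Definition rectifier (R : realType) (V : set 'rV[R]_3) (f G : 'rV[R]_3 -> 'rV[R]_3) :=
  [/\ open V, open (f @` V), smooth_on V f, smooth_on (f @` V) G &
      forall x, V x -> G (f x) = x].

Definition straightened (R : realType) (V : set 'rV[R]_3) (f : 'rV[R]_3 -> 'rV[R]_3)
    (g : set 'rV[R]_3) (A d : 'rV[R]_3) : Prop :=
  forall X, g X -> V X -> exists s, f X = A + s *: d.

Section Rectified.
Variables (R : realType) (V : set 'rV[R]_3) (f G : 'rV[R]_3 -> 'rV[R]_3).
Hypothesis rectV : rectifier V f G.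

Let Vo : open V. Proof. by case: rectV. Qed.
Let fVo : open (f @` V). Proof. by case: rectV. Qed.
Let fs : smooth_on V f. Proof. by case: rectV. Qed.
Let Gs : smooth_on (f @` V) G. Proof. by case: rectV. Qed.
Let Gf x : V x -> G (f x) = x. Proof. by case: rectV => _ _ _ _; apply. Qed.

Lemma rect_diff x : V x -> differentiable f x.
Proof. exact: (fs 1%N).1. Qed.

Lemma rect_inv_diff y : (f @` V) y -> differentiable G y.
Proof. exact: (Gs 1%N).1. Qed.

Lemma rect_invP y : (f @` V) y -> V (G y) /\ f (G y) = y.
Proof. by move=> [x Vx <-]; rewrite Gf. Qed.

Lemma rect_derive x u : V x -> 'D_('D_u f x) G (f x) = u.
Proof.
move=> Vx; apply: derive_left_inverse; [exact: rect_diff| |].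
  by apply: rect_inv_diff; exists x.
by apply: filterS (open_nbhs_nbhs (conj Vo Vx)) => y; exact: Gf.
Qed.

Lemma rect_inv_derive y v : (f @` V) y -> 'D_('D_v G y) f (G y) = v.
Proof.
move=> Vy; have [VG fG] := rect_invP Vy.
apply: derive_left_inverse; [exact: rect_inv_diff|exact: rect_diff|].
by apply: filterS (open_nbhs_nbhs (conj fVo Vy)) => z /rect_invP[].
Qed.

Lemma is_derive_comp_curve (c : R -> 'rV[R]_3) (u : 'rV[R]_3) :
  is_derive (0 : R) (1 : R) c u -> V (c 0) ->
  is_derive (0 : R) (1 : R) (fun t => f (c t)) ('D_u f (c 0)).
Proof.
move=> [c1 <-] Vc; have dc : differentiable c 0 by exact/derivable1_diffP.
have dfc := rect_diff Vc.
have df : differentiable (f \o c) 0 by exact: differentiable_comp.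
split; first exact/derivable1_diffP.
rewrite (deriveE _ dc) (deriveE _ dfc); transitivity ('D_1 (f \o c) 0); first by [].
rewrite (deriveE _ df).
exact: (congr1 (fun F : R -> 'rV[R]_3 => F 1) (diff_comp dc dfc)).
Qed.

(** The coordinate h of the image of the motion c on its line is obtained by
    orthogonal projection on d, so that it is differentiable. *)
Lemma straightened_motion g A d (c : R -> 'rV[R]_3) u :
  straightened V f g A d -> d != 0 -> V (c 0) -> (\forall t \near (0 : R), g (c t)) ->
  is_derive (0 : R) (1 : R) c u ->
  exists2 h : R -> R, h = (fun t => dot (f (c t) - f (c 0)) d / dot d d) &
  exists s, [/\ is_derive (0 : R) (1 : R) h s, 'D_u f (c 0) = s *: d &
     \forall t \near (0 : R), [/\ V (c t), g (c t) & f (c t) = f (c 0) + h t *: d]].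
Proof.
move=> gAd d0 Vc gc dc; pose h t := dot (f (c t) - f (c 0)) d / dot d d; exists h => //.
have dd : dot d d != 0 by rewrite dot_eq0.
have Vct : \forall t \near (0 : R), V (c t).
  have cc : {for (0 : R), continuous c}.
    by apply/differentiable_continuous/derivable1_diffP; case: dc.
  by apply: cc; exact: open_nbhs_nbhs.
have hf : \forall t \near (0 : R), [/\ V (c t), g (c t) & f (c t) = f (c 0) + h t *: d].
  have [s0 h0] := gAd _ (nbhs_singleton gc) Vc.
  apply: filterS2 Vct gc => t Vt gt; split => //.
  have [s hs] := gAd _ gt Vt.
  rewrite /h hs h0 opprD addrACA subrr add0r -scalerBl dotZl mulfK//.
  by rewrite -addrA -scalerDl [s0 + _]addrC subrK.
have dfc := is_derive_comp_curve dc Vc.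
have dh : is_derive (0 : R) (1 : R) h (dot ('D_u f (c 0)) d / dot d d).
  have h1 := is_derive_subr (f (c 0)) dfc.
  have h2 : is_derive (0 : R) (1 : R) (fun=> d) 0 by exact: is_derive_cst.
  have h3 := is_derive_dot h1 h2.
  have : is_derive (0 : R) (1 : R) ((dot d d)^-1 \*: (fun t => dot (f (c t) - f (c 0)) d))
    ((dot d d)^-1 *: (dot ('D_u f (c 0)) d + dot (f (c 0) - f (c 0)) 0)).
    exact: is_deriveZ.
  rewrite dot0r addr0 /= => h4; have -> : h = (dot d d)^-1 \*: (fun t => dot (f (c t) - f (c 0)) d).
    by apply/funext => t; rewrite /h mulrC.
  by rewrite mulrC.
exists (dot ('D_u f (c 0)) d / dot d d); split => //.
have h5 : is_derive (0 : R) (1 : R) (fun t => h t *: d - (- f (c 0))) ((dot ('D_u f (c 0)) d / dot d d) *: d).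
  by apply: is_derive_subr; exact: is_derive_scale.
have [_ <-] := h5; have [_ <-] := dfc.
apply: near_eq_derive; apply: filterS hf => t [_ _ ->].
by rewrite opprK addrC.
Qed.

Lemma straightened_tangent g A d Z u : straightened V f g A d -> d != 0 -> V Z ->
  tangent_direction g Z u -> exists2 s, s != 0 & 'D_u f Z = s *: d.
Proof.
move=> gAd d0 VZ [u0 [c [cZ gc dc]]]; subst Z.
have [h _ [s [_ us _]]] := straightened_motion gAd d0 VZ gc dc.
exists s => //; apply: contra_neq u0 => s0.
by rewrite -(rect_derive u VZ) us s0 scale0r derive0.
Qed.

(** The image of g under f is contained in the line; that it fills this line near
    f Z follows from the intermediate value theorem for the coordinate of f (c t),
    c being a regular parametrization of the circle. *)
Lemma straightened_germ g A d Z : is_circle g -> straightened V f g A d -> d != 0 ->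
  V Z -> g Z -> \forall t \near (0 : R), g (G (f Z + t *: d)).
Proof.
move=> gcirc gAd d0 VZ gZ.
have [c [dc [cZ dc0 gc dcE]]] := circle_motion gcirc gZ; subst Z.
have gc' : \forall t \near (0 : R), g (c t).
  by apply: filterE => t; exact: gc.
have [h hE [s [hs us hf]]] := straightened_motion gAd d0 VZ gc' (dcE 0).
have s0 : s != 0.
  apply: contra_neq dc0 => s0.
  by rewrite -(rect_derive (dc 0) VZ) us s0 scale0r derive0.
have h0 : h 0 = 0 by rewrite hE subrr dot0l mul0r.
have hc : \forall t \near (0 : R), {for t, continuous h}.
  apply: filterS hf => t [Vct _ _].
  rewrite hE; apply: continuousM; last exact: cst_continuous.
  apply: (@continuous_comp _ _ _ _ (fun x => dot x d)); last exact: dot_continuous.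
  apply: continuousB; last exact: cst_continuous.
  apply: (@continuous_comp _ _ _ c f).
    by apply/differentiable_continuous/derivable1_diffP; case: (dcE t).
  exact/differentiable_continuous/rect_diff.
apply: filterS (local_IVT h0 hc hs s0 hf) => y [t [Vct gct ft] <-].
by rewrite -ft Gf.
Qed.

End Rectified.

(** * The common pole of the circles through a point *)

Section Poles.
Variables (R : realType) (V : set 'rV[R]_3) (f G : 'rV[R]_3 -> 'rV[R]_3).
Hypothesis rectV : rectifier V f G.

(** In this basis the coordinates of the velocity v of the straight line
    y + t v are those of the velocity at 0 of its image G (y + t v). *)
Definition frame (y : 'rV[R]_3) (i : 'I_3) : 'rV[R]_3 := 'D_(delta_mx 0 i) f (G y).

Lemma frame_comb y u : (f @` V) y -> 'D_u f (G y) = \sum_i u 0 i *: frame y i.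
Proof.
move=> Vy; have [VG _] := rect_invP rectV Vy.
by rewrite {1}[u]row_sum_delta derive_comb//; exact: (rect_diff rectV).
Qed.

Definition ray_jet y (u : 'rV[R]_3) k (t : R) :=
  jet k (frame y) G u (y + t *: 'D_u f (G y)).

Lemma ray_jet0 y u k : ray_jet y u k 0 = jet k (frame y) G u y.
Proof. by rewrite /ray_jet scale0r addr0. Qed.

Lemma near_ray y u : (f @` V) y -> \forall t \near (0 : R), (f @` V) (y + t *: u).
Proof.
move=> Vy; have fVo : open (f @` V) by case: rectV.
have c : {for (0 : R), continuous (fun t : R => y + t *: u)}.
  by apply: continuousD; [exact: cst_continuous|exact: scalel_continuous].
by apply: c; apply: open_nbhs_nbhs; rewrite scale0r addr0.
Qed.

Lemma is_derive_ray_jet y u k : (f @` V) y ->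
  \forall t \near (0 : R), is_derive (t : R) (1 : R) (ray_jet y u k) (ray_jet y u k.+1 t).
Proof.
move=> Vy; apply: filterS (near_ray ('D_u f (G y)) Vy) => t Vt.
rewrite /ray_jet; rewrite !frame_comb// in Vt *.
by apply: is_derive_jet Vt; case: rectV => _ _ _ Gs _; exact: Gs.
Qed.

Lemma ray_jet1 y u : (f @` V) y -> jet 1 (frame y) G u y = u.
Proof.
move=> Vy; have [VG fG] := rect_invP rectV Vy.
rewrite /= -derive_comb; last exact: (rect_inv_diff rectV).
by rewrite -frame_comb//; have := rect_derive rectV u VG; rewrite fG.
Qed.

Lemma ray_on_circle y u (c n : 'rV[R]_3) r : (f @` V) y ->
  (\forall t \near (0 : R), dot (G (y + t *: 'D_u f (G y)) - c) n = 0 /\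
     dot (G (y + t *: 'D_u f (G y)) - c) (G (y + t *: 'D_u f (G y)) - c) = r ^+ 2) ->
  let m := c - G y in let q k := jet k (frame y) G u y in
  (dot n u = 0 /\ dot n (q 2%N) = 0 /\ dot n (q 3%N) = 0 /\ dot n (q 4%N) = 0) /\
  (dot m u = 0 /\ dot m (q 2%N) = dot u u /\
   dot m (q 3%N) = 3 * dot u (q 2%N) /\
   dot m (q 4%N) = 4 * dot u (q 3%N) + 3 * dot (q 2%N) (q 2%N)).
Proof.
move=> Vy hg m q.
have h1 : \forall t \near (0 : R), dot (ray_jet y u 0 t - c) n = 0.
  by apply: filterS hg => t [].
have h2 : \forall t \near (0 : R), dot (ray_jet y u 0 t - c) (ray_jet y u 0 t - c) = r ^+ 2.
  by apply: filterS hg => t [].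
have := circle_derivatives (fun k _ => is_derive_ray_jet u k Vy) h1 h2.
by cbv zeta beta; rewrite !ray_jet0 ray_jet1.
Qed.

(** For u in the given ball, G (y + t D_u f) moves on a circle and the identities
    of [circle_jet] hold; being polynomial in u, they extend to complex u, and
    [isotropic_jet] applies at the vectors e_p + i e_q. *)
Lemma pole_exists y (v0 : 'rV[R]_3) (e : R) : (f @` V) y -> 0 < e ->
  (forall u, `|u - v0| < e -> exists g, [/\ is_circle g, g (G y) &
     \forall t \near (0 : R), g (G (y + t *: 'D_u f (G y)))]) ->
  exists lam w, forall u,
    jet 2 (frame y) G u y = dot lam u *: u + dot u u *: w.
Proof.
move=> Vy e0 hu.
pose b i j := 'D_(frame y j) (fun x => 'D_(frame y i) G x) y.
apply: (@quadratic_map_of_isotropic R b) => p q r pqr /=.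
pose J k (u : 'rV[R]_3) := jet k (frame y) G u y.
pose cJ k (z : 'I_3 -> R[i]) := cjet k (frame y) G z y.
have real_ids u : `|u - v0| < e ->
  [/\ forall k l, u 0 k * (dot u u *: J 3%N u - (3 * dot u (J 2%N u)) *: J 2%N u) 0 l =
                  u 0 l * (dot u u *: J 3%N u - (3 * dot u (J 2%N u)) *: J 2%N u) 0 k,
      forall k l, u 0 k * (dot u u *: J 4%N u - (4 * dot u (J 3%N u) + 3 * dot (J 2%N u) (J 2%N u)) *: J 2%N u) 0 l =
                  u 0 l * (dot u u *: J 4%N u - (4 * dot u (J 3%N u) + 3 * dot (J 2%N u) (J 2%N u)) *: J 2%N u) 0 k
    & u 0 p * (J 2%N u 0 q * J 3%N u 0 r - J 2%N u 0 r * J 3%N u 0 q)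
      + u 0 q * (J 2%N u 0 r * J 3%N u 0 p - J 2%N u 0 p * J 3%N u 0 r)
      + u 0 r * (J 2%N u 0 p * J 3%N u 0 q - J 2%N u 0 q * J 3%N u 0 p) = 0].
  move=> /hu[g [[c [n [rad [n0 rad0 ->]]]] [Gn Gr] hg]].
  have [[n1 [n2 [n3 n4]]] [m1 [m2 [m3 m4]]]] := ray_on_circle Vy hg.
  have mn : dot (c - G y) n = 0 by rewrite -opprB dotNl Gn oppr0.
  have m0 : c - G y != 0.
    by rewrite -dot_eq0 -opprB dotNl dotNr opprK Gr sqrf_eq0 gt_eqF.
  have [i1 i2 i3] := circle_jet m0 n0 mn n1 n2 n3 n4 m1 m2 m3 m4.
  by split => //; exact: i3.
pose z (k : 'I_3) : R[i] := ((k == p)%:R +i* (k == q)%:R)%C.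
have zE : z = fun i => ((delta_mx 0 p : 'rV[R]_3) 0 i +i* (delta_mx 0 q : 'rV[R]_3) 0 i)%C.
  by apply/funext => i; rewrite !mxE.
have [pq pr qr] := indices3_neq pqr.
have zp : z p = 1 by rewrite /z eqxx pq.
have zq : z q = 'i%C by rewrite /z eqxx eq_sym pq.
have zr : z r = 0 by rewrite /z eq_sym pr eq_sym qr.
have vanish F : polynomial_fun F ->
    (forall u : 'rV[R]_3, `|u - v0| < e -> F (fun i => (u 0 i)%:C%C) = 0) -> F z = 0.
  by move=> pF F0; rewrite zE; exact: (polynomial_fun_complexify e0 pF F0).
have cJE k (u : 'rV[R]_3) l : cJ k (fun i => (u 0 i)%:C%C) l = (J k u 0 l)%:C%C.
  exact: cjet_real.
have dotCE (u v : 'rV[R]_3) : \sum_k (u 0 k)%:C%C * (v 0 k)%:C%C = (dot u v)%:C%C.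
  by rewrite rmorph_sum; apply: eq_bigr => k _; rewrite rmorphM.
pose Q (x : 'I_3 -> R[i]) := \sum_k x k * x k.
pose xB (x : 'I_3 -> R[i]) := \sum_k x k * cJ 2%N x k.
pose xC (x : 'I_3 -> R[i]) := \sum_k x k * cJ 3%N x k.
pose BB (x : 'I_3 -> R[i]) := \sum_k cJ 2%N x k * cJ 2%N x k.
have pJ k l : polynomial_fun (fun x => cJ k x l) by exact: polynomial_cjet.
have pv k : polynomial_fun (fun x : 'I_3 -> R[i] => x k) by exact: PolyVar.
have pQ : polynomial_fun Q by apply: polynomial_fun_sum => k; exact: PolyMul.
have pxB : polynomial_fun xB by apply: polynomial_fun_sum => k; exact: PolyMul.
have pxC : polynomial_fun xC by apply: polynomial_fun_sum => k; exact: PolyMul.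
have pBB : polynomial_fun BB by apply: polynomial_fun_sum => k; exact: PolyMul.
have QE (u : 'rV[R]_3) : Q (fun i => (u 0 i)%:C%C) = (dot u u)%:C%C by exact: dotCE.
have xBE (u : 'rV[R]_3) : xB (fun i => (u 0 i)%:C%C) = (dot u (J 2%N u))%:C%C.
  by rewrite -dotCE; apply: eq_bigr => k _; rewrite cJE.
have xCE (u : 'rV[R]_3) : xC (fun i => (u 0 i)%:C%C) = (dot u (J 3%N u))%:C%C.
  by rewrite -dotCE; apply: eq_bigr => k _; rewrite cJE.
have BBE (u : 'rV[R]_3) : BB (fun i => (u 0 i)%:C%C) = (dot (J 2%N u) (J 2%N u))%:C%C.
  by rewrite -dotCE; apply: eq_bigr => k _; rewrite cJE.
have pB2 F1 F2 : polynomial_fun F1 -> polynomial_fun F2 ->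
    polynomial_fun (fun x : 'I_3 -> R[i] => F1 x - F2 x).
  by move=> h1 h2; apply: PolyAdd => //; exact: polynomial_funN.
have pc c F1 : polynomial_fun F1 -> polynomial_fun (fun x : 'I_3 -> R[i] => c * F1 x).
  by move=> h1; apply: PolyMul => //; exact: PolyCst.
pose realC := (rmorphB, rmorphD, rmorphM, rmorph_nat).
apply: (isotropic_jet (sqr_i R) pqr zp zq zr (B := cJ 2%N z) (C := cJ 3%N z) (D := cJ 4%N z)).
- move=> k l; apply/eqP; rewrite -subr_eq0; apply/eqP.
  apply: (vanish (fun x => x k * (Q x * cJ 3%N x l - 3 * xB x * cJ 2%N x l) -
                           x l * (Q x * cJ 3%N x k - 3 * xB x * cJ 2%N x k))).
    by apply: (pB2); apply: PolyMul => //; apply: (pB2); apply: PolyMul => //; exact: pc.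
  move=> u /real_ids[/(_ k l) + _ _]; rewrite !coordE => h.
  rewrite QE xBE !cJE; move/(congr1 (real_complex R))/eqP: h.
  by rewrite -subr_eq0 !realC/= => /eqP.
- move=> k l; apply/eqP; rewrite -subr_eq0; apply/eqP.
  apply: (vanish (fun x => x k * (Q x * cJ 4%N x l - (4 * xC x + 3 * BB x) * cJ 2%N x l) -
                           x l * (Q x * cJ 4%N x k - (4 * xC x + 3 * BB x) * cJ 2%N x k))).
    by apply: (pB2); apply: PolyMul => //; apply: (pB2); apply: PolyMul => //;
      apply: PolyAdd => //; exact: pc.
  move=> u /real_ids[_ /(_ k l) + _]; rewrite !coordE => h.
  rewrite QE xCE BBE !cJE; move/(congr1 (real_complex R))/eqP: h.
  by rewrite -subr_eq0 !realC/= => /eqP.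
- apply: (vanish (fun x => x p * (cJ 2%N x q * cJ 3%N x r - cJ 2%N x r * cJ 3%N x q) +
                           x q * (cJ 2%N x r * cJ 3%N x p - cJ 2%N x p * cJ 3%N x r) +
                           x r * (cJ 2%N x p * cJ 3%N x q - cJ 2%N x q * cJ 3%N x p))).
    by do 2?apply: PolyAdd => //; apply: PolyMul => //; apply: (pB2); apply: PolyMul.
  move=> u /real_ids[_ _ h].
  rewrite !cJE; move/(congr1 (real_complex R)): h.
  by rewrite !realC/= rmorph0.
Qed.

End Poles.

Section Joining.
Variables (R : realType) (V : set 'rV[R]_3) (f G : 'rV[R]_3 -> 'rV[R]_3).
Hypothesis rectV : rectifier V f G.

(** For w != 0, the equations n.w = 0 and (c - Q).w = 1 say that the circle
    passes through the point Q + 2 w / |w|^2, the same for all circles. *)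
Definition pole_at (Delta : set (set 'rV[R]_3)) (Q w : 'rV[R]_3) : Prop :=
  forall (c n : 'rV[R]_3) (r : R), n != 0 -> 0 < r ->
    let g := [set X | dot (X - c) n = 0 /\ dot (X - c) (X - c) = r ^+ 2] in
    Delta g -> g Q -> dot n w = 0 /\ dot (c - Q) w = 1.

(** With B = lam(u) u + |u|^2 w, the second order conditions n.B = 0 and
    m.B = |u|^2 for a circle tangent to u become n.w = 0 and m.w = 1, in which u no
    longer appears: they hold for all the circles of the family through the point,
    whether or not their tangent is in the ball. *)
Lemma pole_of_directions (Delta : set (set 'rV[R]_3)) y (v0 : 'rV[R]_3) (e : R) :
  (forall g, Delta g -> is_circle g) ->
  (forall g, Delta g -> exists A d, d != 0 /\ straightened V f g A d) ->
  (f @` V) y -> 0 < e ->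
  (forall u, `|u - v0| < e -> exists g, Delta g /\ g (G y) /\ tangent_direction g (G y) u) ->
  exists w, pole_at Delta (G y) w.
Proof.
move=> Dc Dl Vy e0 hu; have [VG fG] := rect_invP rectV Vy.
have germ g u : Delta g -> g (G y) -> tangent_direction g (G y) u ->
    \forall t \near (0 : R), g (G (y + t *: 'D_u f (G y))).
  move=> Dg gy gu; have [A [d [d0 gAd]]] := Dl _ Dg.
  have [s s0 ->] := straightened_tangent rectV gAd d0 VG gu.
  have := straightened_germ rectV (Dc _ Dg) gAd d0 VG gy.
  rewrite fG => h.
  have c : t * s @[t --> (0 : R)] --> (0 : R).
    by rewrite -[X in _ --> X](mul0r s); apply: cvgM; [exact: cvg_id|exact: cvg_cst].
  have h2 : \forall t \near (0 : R), g (G (y + (t * s) *: d)) by exact: (c _ h).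
  by apply: filterS h2 => t; rewrite scalerA.
have [|lam [w hw]] := pole_exists rectV Vy e0 (v0 := v0).
  move=> u /hu[g [Dg [gy gu]]]; exists g; split => //; first exact: Dc.
  exact: germ.
exists w => c n r n0 r0 g Dg gy.
have [cm [dc [cm0 dc0 gc dcE]]] := circle_motion (Dc _ Dg) gy.
have tg : tangent_direction g (G y) (dc 0).
  by split => //; exists cm; split => //; apply: filterE => t; exact: gc.
have [[n1 [n2 _]] [m1 [m2 _]]] := ray_on_circle rectV Vy (germ _ _ Dg gy tg).
have uu : dot (dc 0) (dc 0) != 0 by rewrite dot_eq0.
split; apply: (mulfI uu).
  by move: n2; rewrite hw dotDr !dotZr n1 !mulr0 add0r.
by move: m2; rewrite hw dotDr !dotZr m1 mulr0 add0r mulr1.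
Qed.

(** In the interval S, the parameters of the points of g form a subset which is
    open by [straightened_germ], closed as g is closed, and not empty. *)
Lemma straightened_segment g (y0 d : 'rV[R]_3) (A : 'rV[R]_3) (S : set R) :
  is_circle g -> straightened V f g A d -> d != 0 -> is_interval S ->
  (forall s, S s -> (f @` V) (y0 + s *: d)) ->
  (exists2 s, S s & g (G (y0 + s *: d))) -> forall s, S s -> g (G (y0 + s *: d)).
Proof.
move=> gc gAd d0 Si SV [s0 Ss0 gs0].
have fVo : open (f @` V) by case: rectV.
have lc (s : R) : {for s, continuous (fun t : R => y0 + t *: d)}.
  by apply: continuousD; [exact: cst_continuous|exact: scalel_continuous].
have VS (s : R) : (f @` V) (y0 + s *: d) -> \forall t \near s, (f @` V) (y0 + t *: d).
  by move=> Vs; apply: (lc s); exact: open_nbhs_nbhs.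
pose T := [set s | (f @` V) (y0 + s *: d) /\ g (G (y0 + s *: d))].
pose T' := [set s | (f @` V) (y0 + s *: d) /\ ~ g (G (y0 + s *: d))].
have To : open T.
  rewrite openE => s [Vs gs]; have VS' := VS _ Vs.
  have [VG fG] := rect_invP rectV Vs.
  have := straightened_germ rectV gc gAd d0 VG gs; rewrite fG => h.
  have c : t - s @[t --> s] --> (0 : R).
    by rewrite -[X in _ --> X](subrr s); apply: cvgB; [exact: cvg_id|exact: cvg_cst].
  have h2 : \forall t \near s, g (G (y0 + s *: d + (t - s) *: d)) by exact: (c _ h).
  apply: filterS2 VS' h2 => t Vt /=.
  by rewrite -addrA -scalerDl [s + _]addrC subrK.
have T'o : open T'.
  rewrite openE => s [Vs gs]; have VS' := VS _ Vs.
  have Gc : {for s, continuous (fun t : R => G (y0 + t *: d))}.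
    apply: continuous_comp; first exact: lc.
    exact/differentiable_continuous/(rect_inv_diff rectV).
  have h2 : \forall t \near s, ~ g (G (y0 + t *: d)).
    apply: (Gc (~` g)); apply: open_nbhs_nbhs; split => //.
    by apply: closed_openC; exact: circle_closed.
  exact: filterS2 VS' h2.
have ST : S `&` T = S.
  apply: (connected_intervalP S).2 => //.
  - by exists s0; split => //; split => //; exact: SV.
  - by exists T.
  - exists (~` T'); first exact: open_closedC.
    apply/seteqP; split => s [Ss].
      by move=> [_ gs]; split => // -[].
    move=> T's; split => //; split; first exact: SV.
    by apply: contrapT => ngs; apply: T's; split => //; exact: SV.
by move=> s; rewrite -{1}ST => -[_ []].
Qed.

End Joining.

(** * Circles as planes of RP^4 *)

Section Concurrency.

(** In projective terms, LA, LB and LX are lines which are pairwise coplanar and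
    therefore meet pairwise. Were the points of LX on LA and on LB distinct, they
    would span LX, which would lie in the plane pAB; so LA, LB and LX have a common
    point. *)
Lemma concurrent_lines (F : fieldType) n (LA LB LX : 'M[F]_(2, n))
    (pAB pAX pBX : 'M[F]_n) :
  \rank LA = 2%N -> \rank LB = 2%N -> \rank LX = 2%N ->
  (\rank pAB <= 3)%N -> (\rank pAX <= 3)%N -> (\rank pBX <= 3)%N ->
  (LA <= pAB)%MS -> (LB <= pAB)%MS -> (LA <= pAX)%MS -> (LX <= pAX)%MS ->
  (LB <= pBX)%MS -> (LX <= pBX)%MS ->
  ~~ (LX <= pAB)%MS -> ~~ (LB <= pAX)%MS ->
  \rank (LA :&: LB)%MS = 1%N /\ (LA :&: LB <= LX)%MS.
Proof.
move=> rA rB rX rAB rAX rBX AAB BAB AAX XAX BBX XBX XAB BAX.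
have cap1 (L L' : 'M[F]_(2, n)) (p : 'M[F]_n) : \rank L = 2%N -> \rank L' = 2%N ->
    (\rank p <= 3)%N -> (L <= p)%MS -> (L' <= p)%MS -> (0 < \rank (L :&: L')%MS)%N.
  move=> r r' rp Lp L'p; have := mxrank_sum_cap L L'; rewrite r r'.
  have : (\rank (L + L')%MS <= 3)%N.
    by apply: leq_trans rp; apply: mxrankS; rewrite addsmx_sub Lp.
  by case: (\rank (L :&: L')%MS) => //; rewrite addn0 => /[swap] ->.
have AB1 : \rank (LA :&: LB)%MS = 1%N.
  apply/eqP; rewrite eqn_leq (cap1 _ _ pAB)// andbT leqNgt; apply/negP => AB2.
  have : (LB <= LA :&: LB)%MS by rewrite -(geq_leqif (mxrank_leqif_sup (capmxSr LA LB))) rB.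
  by rewrite sub_capmx => /andP[BA _]; move/negP: BAX; apply; exact: submx_trans AAX.
split => //.
pose S := (LA :&: LX + LB :&: LX)%MS.
have SX : (S <= LX)%MS by rewrite addsmx_sub !capmxSr.
have S1 : (\rank S <= 1)%N.
  rewrite leqNgt; apply/negP => S2.
  have : (LX <= S)%MS by rewrite -(geq_leqif (mxrank_leqif_sup SX)) rX.
  move=> XS; move/negP: XAB; apply; apply: submx_trans XS _.
  rewrite addsmx_sub (submx_trans (capmxSl _ _) AAB).
  by rewrite (submx_trans (capmxSl _ _) BAB).
have AXS : (S <= LA :&: LX)%MS.
  rewrite -(geq_leqif (mxrank_leqif_sup (addsmxSl _ _))) (leq_trans S1)//.
  exact: (cap1 _ _ pAX).
have BXS : (S <= LB :&: LX)%MS.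
  rewrite -(geq_leqif (mxrank_leqif_sup (addsmxSr _ _))) (leq_trans S1)//.
  exact: (cap1 _ _ pBX).
have SAB : (S <= LA :&: LB)%MS.
  by rewrite sub_capmx (submx_trans AXS (capmxSl _ _)) (submx_trans BXS (capmxSl _ _)).
apply: submx_trans SX.
rewrite -(geq_leqif (mxrank_leqif_sup SAB)) AB1.
by apply: leq_trans (mxrankS (addsmxSl _ _)); exact: (cap1 _ _ pAX).
Qed.

Variable R : realType.

(** Homogeneous coordinates of RP^4. The lift of a point P + Y of R^3 is
    [point5 |Y|^2 Y 1]. *)
Definition point5 (s : R) (Y : 'rV[R]_3) (t : R) : 'rV[R]_(1 + (3 + 1)) :=
  row_mx s%:M (row_mx Y t%:M).

(** The two linear forms on R^5 which cut out the plane of the circle of centre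
    P + m, normal n and radius r, where rho = |m|^2 - r^2. *)
Definition circle_eqs (m n : 'rV[R]_3) (rho : R) : 'M[R]_(1 + (3 + 1), 1 + 1) :=
  row_mx (col_mx 0 (col_mx n^T (- dot n m)%:M)) (col_mx 1%:M (col_mx (- 2 *: m^T) rho%:M)).

Lemma mulmx_tr_dot (Y n : 'rV[R]_3) : Y *m n^T = (dot Y n)%:M.
Proof.
apply/matrixP => i j; rewrite !ord1 !mxE eqxx mulr1n.
by apply: eq_bigr => k _; rewrite mxE.
Qed.

Lemma scalar_mx11_eq0 (x : R) : (x%:M == 0 :> 'M[R]_1) = (x == 0).
Proof.
apply/eqP/eqP => [/matrixP/(_ 0 0)|->]; last by rewrite raddf0.
by rewrite !mxE eqxx mulr1n.
Qed.

Lemma point5_circle s Y t m n rho :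
  reflect (dot Y n = t * dot n m /\ s - 2 * dot Y m + rho * t = 0)
    (point5 s Y t <= kermx (circle_eqs m n rho))%MS.
Proof.
have -> : (point5 s Y t <= kermx (circle_eqs m n rho))%MS =
    (dot Y n - t * dot n m == 0) && (s - 2 * dot Y m + rho * t == 0).
  rewrite sub_kermx /point5 /circle_eqs mul_mx_row !mul_row_col mulmx0 add0r mulmx1.
  rewrite -scalemxAr !mulmx_tr_dot -!scalar_mxM scale_scalar_mx -!raddfD/= row_mx_eq0.
  by rewrite !scalar_mx11_eq0; congr (_ && _); congr (_ == _); ring.
apply: (iffP andP) => [[/eqP/subr0_eq h1 /eqP h2]|[h1 h2]]; first by split.
by rewrite h1 h2 subrr eqxx.
Qed.

Lemma rank_circle_eqs m n rho : n != 0 -> (\rank (kermx (circle_eqs m n rho)) <= 3)%N.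
Proof.
move=> n0; rewrite mxrank_ker -mxrank_tr; suff /eqP -> : row_free (circle_eqs m n rho)^T by [].
apply: inj_row_free => v; rewrite -[v]hsubmxK tr_row_mx mul_row_col !tr_col_mx.
rewrite !mul_mx_row trmx0 mulmx0 add_row_mx => /eqP; rewrite row_mx_eq0 add0r.
rewrite trmx1 mulmx1 => /andP[/eqP -> ].
rewrite !mul0mx row_mx0 addr0 row_mx_eq0 trmxK => /andP[/eqP h _].
suff -> : lsubmx v = 0 by rewrite row_mx0.
move: h; rewrite [lsubmx v]mx11_scalar mul_scalar_mx => /eqP.
by rewrite scaler_eq0 (negPf n0) orbF => /eqP ->; rewrite raddf0.
Qed.

(** For w != 0, the line which joins the lifts of Q = P + Y and of
    Q + 2 w / |w|^2; for w = 0 the second point is (2, 0, 0), which the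
    lifts approach at infinity. *)
Definition pole_line (Y w : 'rV[R]_3) : 'M[R]_(1 + 1, 1 + (3 + 1)) :=
  col_mx (point5 (dot Y Y) Y 1) (point5 (2 + 2 * dot Y w) w 0).

Lemma point5Z k s Y t : k *: point5 s Y t = point5 (k * s) (k *: Y) (k * t).
Proof. by rewrite /point5 !scale_row_mx !scale_scalar_mx. Qed.

Lemma point5D s Y t s' Y' t' :
  point5 s Y t + point5 s' Y' t' = point5 (s + s') (Y + Y') (t + t').
Proof. by rewrite /point5 !add_row_mx -!raddfD. Qed.

Lemma point5_eq0 s Y t : point5 s Y t = 0 -> [/\ s = 0, Y = 0 & t = 0].
Proof.
move/eqP; rewrite !row_mx_eq0 !scalar_mx11_eq0 => /and3P[/eqP h1 /eqP -> /eqP h2].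
by split.
Qed.

Lemma rank_pole_line Y w : \rank (pole_line Y w) = 2%N.
Proof.
apply/eqP; rewrite -[_ == _]/(row_free (pole_line Y w)); apply: inj_row_free => v.
rewrite -[v]hsubmxK mul_row_col [lsubmx v]mx11_scalar [rsubmx v]mx11_scalar.
rewrite !mul_scalar_mx !point5Z point5D; set a := lsubmx v 0 0; set b := rsubmx v 0 0.
case/point5_eq0; rewrite mulr0 addr0 mulr1 => + + a0.
rewrite a0 scale0r mul0r !add0r => h /eqP; rewrite scaler_eq0 => /orP[/eqP ->|/eqP w0].
  by rewrite raddf0 row_mx0.
move: h; rewrite w0 dot0r mulr0 addr0 => /eqP; rewrite mulf_eq0 pnatr_eq0 orbF => /eqP ->.
by rewrite raddf0 row_mx0.
Qed.

Lemma pole_line_sub_circle P Q w c n r :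
  dot (Q - c) n = 0 -> dot (Q - c) (Q - c) = r ^+ 2 -> dot n w = 0 -> dot (c - Q) w = 1 ->
  (pole_line (Q - P) w <=
     kermx (circle_eqs (c - P) n (dot (c - P) (c - P) - r ^+ 2)))%MS.
Proof.
move=> Qn Qr nw cw; rewrite col_mx_sub; apply/andP; split; apply/point5_circle.
- rewrite -Qr; move: Qn; rewrite !dotE !(dotC n) (dotC c Q) (dotC P Q) (dotC P c).
  by move=> h; split; lra.
- rewrite mul0r mulr0 addr0; split; first by rewrite dotC.
  move: cw; rewrite !dotE (dotC w c) (dotC w P); lra.
Qed.

Lemma on_circle_of_sub P Q c n r :
  (point5 (dot (Q - P) (Q - P)) (Q - P) 1 <=
     kermx (circle_eqs (c - P) n (dot (c - P) (c - P) - r ^+ 2)))%MS ->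
  dot (Q - c) n = 0 /\ dot (Q - c) (Q - c) = r ^+ 2.
Proof.
move/point5_circle.
rewrite !dotE !(dotC n) (dotC c Q) (dotC P Q) (dotC P c) => -[h1 h2]; split; lra.
Qed.

End Concurrency.

(** * Joining nearby points by circles of the family *)

Section Geometry.
Variables (R : realType) (V : set 'rV[R]_3) (f G : 'rV[R]_3 -> 'rV[R]_3).
Hypothesis rectV : rectifier V f G.

Lemma inv_derive_expand y (v : 'rV[R]_3) : (f @` V) y ->
  'D_v G y = \sum_i v 0 i *: 'D_(delta_mx 0 i) G y.
Proof.
move=> Vy; rewrite {1}[v]row_sum_delta derive_comb//.
exact: (rect_inv_diff rectV).
Qed.

Lemma inv_derive_cvg y (v : 'rV[R]_3) : (f @` V) y ->
  (fun z : 'rV[R]_3 * 'rV[R]_3 => \sum_i z.2 0 i *: 'D_(delta_mx 0 i) G z.1) @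
    nbhs (y, v) --> 'D_v G y.
Proof.
move=> Vy; rewrite inv_derive_expand//.
have hc i : {for y, continuous (fun x : 'rV[R]_3 => 'D_(delta_mx 0 i) G x)}.
  case: rectV => _ _ _ Gs _; have [_ /(_ (delta_mx 0 i))[h _]] := Gs 2%N.
  have hy := h _ Vy; exact: (differentiable_continuous hy).
apply: cvg_big => [|i _]; first exact: add_continuous.
apply: cvgZ.
  apply: (@cvg_comp _ _ _ (fun z : 'rV[R]_3 * 'rV[R]_3 => z.2) (fun x : 'rV[R]_3 => x 0 i)
    _ (nbhs v)); first exact: cvg_snd.
  exact: coord_continuous.
apply: (@cvg_comp _ _ _ (fun z : 'rV[R]_3 * 'rV[R]_3 => z.1)
  (fun x : 'rV[R]_3 => 'D_(delta_mx 0 i) G x) _ (nbhs y)); first exact: cvg_fst.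
exact: hc.
Qed.

(** The derivative of G is jointly continuous in the point and in the vector, and
    it sends D_v0 f P to v0. *)
Lemma uniform_directions P (v0 : 'rV[R]_3) (e : R) (good : set 'rV[R]_3) :
  V P -> 0 < e -> (\forall Q \near P, good Q) ->
  exists2 d : R, 0 < d & forall y, `|y - f P| < d ->
    [/\ (f @` V) y, good (G y) &
       forall v, `|v - 'D_v0 f P| < d -> `|'D_v G y - v0| < e].
Proof.
move=> VP e0 Pgood; have Vp : (f @` V) (f P) by exists P.
have Gfx : G (f P) = P by case: rectV => _ _ _ _; apply.
have n1 : \forall y \near f P, (f @` V) y.
  by apply: open_nbhs_nbhs; split => //; case: rectV.
have n2 : \forall y \near f P, good (G y).
  have Gc : {for f P, continuous G}.
    exact/differentiable_continuous/(rect_inv_diff rectV).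
  by apply: (Gc good); rewrite Gfx.
have /cvgrPdist_lt /(_ _ e0) := @inv_derive_cvg (f P) ('D_v0 f P) Vp.
rewrite (rect_derive rectV)// => -[[A B] /= [nA nB] AB].
have /nbhs_ballP[d1 /= d10 h1] : nbhs (f P) ([set y | (f @` V) y] `&` [set y | good (G y)] `&` A).
  by apply: filterI => //; exact: filterI.
have /nbhs_ballP[d2 /= d20 h2] := nB.
exists (Num.min d1 d2); first by rewrite lt_min d10.
move=> y; rewrite lt_min => /andP[y1 y2].
have [[Vy gy] Ay] : ([set y | (f @` V) y] `&` [set y | good (G y)] `&` A) y.
  by apply: h1; rewrite -ball_normE /= distrC.
split => // v; rewrite lt_min => /andP[_ v2].
have Bv : B v by apply: h2; rewrite -ball_normE /= distrC.
by have := AB (y, v) (conj Ay Bv); rewrite /= inv_derive_expand// distrC.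
Qed.

Lemma is_interval_ball (p y v : 'rV[R]_3) (d : R) :
  is_interval [set s : R | `|y + s *: v - p| < d].
Proof.
move=> s t /= hs ht z /andP[sz zt].
have [st|st] := eqVneq s t.
  by have -> : z = s by apply/eqP; rewrite eq_le {1}st zt sz.
have ts : 0 < t - s by rewrite subr_gt0 lt_neqAle st (le_trans sz zt).
have [k [k0 k1 zE]] : exists k : R, [/\ 0 <= k, k <= 1 & z = (1 - k) * s + k * t].
  exists ((z - s) / (t - s)); split.
  - by rewrite divr_ge0 ?(ltW ts)// subr_ge0.
  - by rewrite ler_pdivrMr// mul1r lerD2r.
  - by field; rewrite gt_eqF.
have -> : y + z *: v - p = (1 - k) *: (y + s *: v - p) + k *: (y + t *: v - p).
  by rewrite zE; apply/rowP => i; rewrite !mxE; ring.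
apply: (le_lt_trans (ler_normD _ _)); rewrite !normrZ !ger0_norm ?subr_ge0//.
have [->|k0'] := eqVneq k 0; first by rewrite subr0 mul1r mul0r addr0.
have kp : 0 < k by rewrite lt_def k0' k0.
have -> : d = (1 - k) * d + k * d by ring.
by apply: ler_ltD; [apply: ler_wpM2l; rewrite ?subr_ge0// ltW|rewrite ltr_pM2l].
Qed.

(** The derivative of G sends directions close to v1 into the ball around v0, where
    a circle of the family is available; [straightened_segment] then follows this
    circle along the whole chord. *)
Lemma joining (Delta : set (set 'rV[R]_3)) (p v0 v1 : 'rV[R]_3) (d e : R) :
  (forall g, Delta g -> is_circle g) ->
  (forall g, Delta g -> exists A d, d != 0 /\ straightened V f g A d) ->
  (forall y, `|y - p| < d ->
    [/\ (f @` V) y,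
        forall u, `|u - v0| < e -> exists g, Delta g /\ g (G y) /\ tangent_direction g (G y) u &
        forall v, `|v - v1| < d -> `|'D_v G y - v0| < e]) ->
  forall y v, `|y - p| < d -> `|v - v1| < d ->
  exists g, [/\ Delta g, straightened V f g y v &
    forall s, `|y + s *: v - p| < d -> g (G (y + s *: v))].
Proof.
move=> Dc Dl hB y v yp vv1; have [Vy hu /(_ _ vv1)/hu[g [Dg [gy gt]]]] := hB _ yp.
have [A [d' [d0 gAd]]] := Dl _ Dg; have [VG fG] := rect_invP rectV Vy.
have [s s0] := straightened_tangent rectV gAd d0 VG gt.
rewrite (rect_inv_derive rectV)// => vE.
have gyv : straightened V f g y v.
  move=> X gX VX; have [s1 ->] := gAd _ gX VX; have := gAd _ gy VG.
  rewrite fG => -[s2 ->]; exists ((s1 - s2) / s).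
  by rewrite vE scalerA divfK// -addrA -scalerDl [s2 + _]addrC subrK.
exists g; split => //; apply: (straightened_segment rectV (Dc _ Dg) gyv).
- by rewrite vE scaler_eq0 negb_or s0.
- exact: is_interval_ball.
- by move=> s' /= /hB[].
- by exists 0 => /=; rewrite scale0r addr0.
Qed.

End Geometry.

(** * The centre of projection *)

Section CommonPoint.
Variables (R : realType) (V : set 'rV[R]_3) (f G : 'rV[R]_3 -> 'rV[R]_3).
Hypothesis rectV : rectifier V f G.

Lemma plane_of_circle (Delta : set (set 'rV[R]_3)) P g :
  (forall g, Delta g -> is_circle g) -> Delta g ->
  exists pi : 'M[R]_(1 + (3 + 1)), [/\ (\rank pi <= 3)%N,
    forall Q w, g Q -> pole_at Delta Q w -> (pole_line (Q - P) w <= pi)%MS &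
    forall Q, (point5 (dot (Q - P) (Q - P)) (Q - P) 1 <= pi)%MS -> g Q].
Proof.
move=> Dc Dg; have [c [n [r [n0 r0 gE]]]] := Dc _ Dg.
exists (kermx (circle_eqs (c - P) n (dot (c - P) (c - P) - r ^+ 2))); split.
- exact: rank_circle_eqs.
- move=> Q w + /(_ c n r n0 r0) /=; rewrite -gE => gQ /(_ Dg).
  rewrite gE in gQ; case: gQ => Qn Qr /(_ (conj Qn Qr))[nw cw].
  exact: pole_line_sub_circle.
- by move=> Q /on_circle_of_sub; rewrite gE.
Qed.

Lemma pole_line_point (Y w : 'rV[R]_3) (pi : 'M[R]_(1 + (3 + 1))) :
  (pole_line Y w <= pi)%MS -> (point5 (dot Y Y) Y 1 <= pi)%MS.
Proof. by rewrite col_mx_sub => /andP[]. Qed.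

(** The conclusion says that the point (2, w, alpha) of RP^4, in coordinates
    centred at P, lies in the planes of all the circles of the family that pass
    near P. It is found as the common point of the lines L_a and L_b of two points
    a and b close to f P, almost in the direction v1 from it but not aligned with
    it, so that the chords from a to b and from any x close to f P to a and b have
    directions close to v1. *)
Lemma projection_center (Delta : set (set 'rV[R]_3)) (P v0 : 'rV[R]_3) (e : R) :
  (forall g, Delta g -> is_circle g) ->
  (forall g, Delta g -> exists A d, d != 0 /\ straightened V f g A d) ->
  V P -> v0 != 0 -> 0 < e ->
  (\forall Q \near P, forall u, `|u - v0| < e ->
     exists g, Delta g /\ g Q /\ tangent_direction g Q u) ->
  exists (w : 'rV[R]_3) (alpha : R), \forall Q \near P,
    forall (c n : 'rV[R]_3) (r : R), n != 0 -> 0 < r ->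
    let g := [set X | dot (X - c) n = 0 /\ dot (X - c) (X - c) = r ^+ 2] in
    Delta g -> g Q ->
    dot n w = alpha * dot n (c - P) /\
    alpha * (dot (c - P) (c - P) - r ^+ 2) + 2 = 2 * dot (c - P) w.
Proof.
move=> Dc Dl VP v00 e0 rich.
set p := f P; set v1 : 'rV[R]_3 := 'D_v0 f P.
have GP : G p = P by case: rectV => _ _ _ _; apply.
have v10 : v1 != 0.
  by apply: contra_neq v00 => v1E; rewrite -(rect_derive rectV v0 VP) -/v1 v1E derive0.
have [d d0 hB] := uniform_directions rectV v0 VP e0 rich.
have J := joining rectV Dc Dl hB.
have fG y : `|y - p| < d -> V (G y) /\ f (G y) = y.
  by move=> /hB[Vy _ _]; exact: (rect_invP rectV Vy).
have pole y : `|y - p| < d -> exists w, pole_at Delta (G y) w.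
  by move=> /hB[Vy hu _]; exact: (pole_of_directions rectV Dc Dl Vy e0 hu).
(* E is a direction independent of v1; the coordinates i and j witness this. *)
have [i v1i] : exists i, v1 0 i != 0.
  apply: contrapT => h; move/eqP: v10; apply; apply/rowP => i; rewrite [RHS]mxE.
  by apply: contrapT => /eqP v1i; apply: h; exists i.
have [j ji] : exists j : 'I_3, j != i.
  by exists (i + 1); case: (ord3P i) => ->.
pose E : 'rV[R]_3 := delta_mx 0 j.
pose k := d / (2 * (`|E| + 1)).
pose F : 'rV[R]_3 := k *: E.
have E1 : 0 < `|E| + 1 by rewrite ltr_wpDl.
have k0 : 0 < k by rewrite divr_gt0// mulr_gt0.
have Fd : `|F| < d / 2.
  rewrite normrZ ger0_norm ?(ltW k0)// /k.
  rewrite mulrAC ltr_pdivrMr; last by rewrite mulr_gt0.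
  have -> : d / 2 * (2 * (`|E| + 1)) = d * (`|E| + 1) by field.
  by rewrite ltr_pM2l// ltrDl.
have Fi : F 0 i = 0 by rewrite !mxE eqxx eq_sym (negPf ji) mulr0.
have Fj : F 0 j = k by rewrite !mxE !eqxx mulr1.
clearbody F k.
(* tau is so small that a and b below belong to the ball of radius d. *)
pose tau := d / (2 * `|v1| + d + 1).
have den : 0 < 2 * `|v1| + d + 1 by rewrite ltr_wpDl// addr_ge0 ?mulr_ge0// ltW.
have tau0 : 0 < tau by rewrite divr_gt0.
have tau1 : tau < 1.
  by rewrite /tau ltr_pdivrMr// mul1r; have := normr_ge0 v1; lra.
have tauE : tau * (2 * `|v1| + d + 1) = d by rewrite /tau divfK// gt_eqF.
clearbody tau.
pose a : 'rV[R]_3 := p + tau *: v1; pose b : 'rV[R]_3 := p + tau *: (2 *: v1 + F).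
have ap : `|a - p| < d.
  rewrite /a addrC addKr normrZ ger0_norm ?(ltW tau0)// -[X in _ < X]tauE ltr_pM2l//.
  by have := normr_ge0 v1; lra.
have bp : `|b - p| < d.
  rewrite /b addrC addKr normrZ ger0_norm ?(ltW tau0)// -[X in _ < X]tauE ltr_pM2l//.
  apply: (le_lt_trans (ler_normD _ _)); rewrite normrZ ger0_norm//; lra.
(* A minor of the matrix of u and v: it is not zero only for independent u and v. *)
pose mn (u v : 'rV[R]_3) := u 0 i * v 0 j - u 0 j * v 0 i.
have mnZ (s t : R) (v : 'rV[R]_3) : mn (s *: v) (t *: v) = 0 by rewrite /mn !mxE; ring.
have near_p : \forall x \near p, `|x - p| < tau * (d / 2) /\ mn (a - x) (b - x) != 0.
  apply: filterI.
    apply/nbhs_ballP; exists (tau * (d / 2)); rewrite /= ?mulr_gt0//.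
    by move=> x; rewrite -ball_normE /= distrC.
  have mnc : {for p, continuous (fun x : 'rV[R]_3 => mn (a - x) (b - x))}.
    have cc (y : 'rV[R]_3) l : {for p, continuous (fun x : 'rV[R]_3 => (y - x) 0 l)}.
      apply: (@continuous_comp _ _ _ (fun x : 'rV[R]_3 => y - x) (fun z : 'rV[R]_3 => z 0 l)).
        by apply: continuousB; [exact: cst_continuous|exact: id].
      exact: coord_continuous.
    by apply: continuousB; apply: continuousM; exact: cc.
  have mnp : mn (a - p) (b - p) != 0.
    have -> : mn (a - p) (b - p) = tau ^+ 2 * k * v1 0 i.
      have -> : a - p = tau *: v1 by rewrite /a addrC addKr.
      have -> : b - p = tau *: (2 *: v1 + F) by rewrite /b addrC addKr.
      by rewrite /mn !coordE Fi Fj; ring.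
    by rewrite !mulf_neq0 ?expf_neq0 ?(gt_eqF tau0) ?(gt_eqF k0).
  by apply: (mnc [set z | z != 0]); apply: open_nbhs_nbhs; split => //; exact: open_neq.
have dir x : `|x - p| < tau * (d / 2) ->
    `|tau^-1 *: (a - x) - v1| < d /\ `|(2 * tau)^-1 *: (b - x) - v1| < d.
  move=> xp; have h : `|tau^-1 *: (p - x)| < d / 2.
    by rewrite normrZ distrC ger0_norm ?invr_ge0 ?(ltW tau0)// mulrC ltr_pdivrMr// mulrC.
  have tn : tau != 0 by rewrite gt_eqF.
  split.
    have -> : tau^-1 *: (a - x) - v1 = tau^-1 *: (p - x).
      by apply/rowP => l; rewrite !mxE; field.
    by apply: lt_trans h _; lra.
  have -> : (2 * tau)^-1 *: (b - x) - v1 = 2^-1 *: (F + tau^-1 *: (p - x)).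
    by apply/rowP => l; rewrite !mxE; field.
  rewrite normrZ ger0_norm//.
  by have := ler_normD F (tau^-1 *: (p - x)); lra.
have tn : tau != 0 by rewrite gt_eqF.
have small x : `|x - p| < tau * (d / 2) -> `|x - p| < d.
  move/lt_trans; apply; have : tau * (d / 2) < 1 * (d / 2) by rewrite ltr_pM2r ?divr_gt0.
  lra.
have [Va fa] := fG _ ap; have [Vb fb] := fG _ bp.
have go (s : R) (x y : 'rV[R]_3) : s != 0 -> x + s *: (s^-1 *: (y - x)) = y.
  by move=> s0; rewrite scalerA divff// scale1r addrC subrK.
have vab : `|tau^-1 *: (b - a) - v1| < d.
  have -> : tau^-1 *: (b - a) - v1 = F by apply/rowP => l; rewrite !mxE; field.
  by lra.
have [gab [Dab sab Jab]] := J _ _ ap vab.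
have gabA : gab (G a) by move: (Jab 0); rewrite scale0r addr0; apply.
have gabB : gab (G b).
  by move: (Jab tau); rewrite go//; apply.
have [wa pa] := pole _ ap; have [wb pb] := pole _ bp.
have [pab [rab inab onab]] := plane_of_circle P Dc Dab.
pose LA := pole_line (G a - P) wa; pose LB := pole_line (G b - P) wb.
have not_ab x : `|x - p| < d -> mn (a - x) (b - x) != 0 -> ~ gab (G x).
  move=> xd xmn gx; have [VX fX] := fG _ xd.
  have [s] := sab _ gx VX; rewrite fX => xE; move/eqP: xmn; apply.
  have -> : a - x = (- s / tau) *: (b - a).
    by rewrite xE opprD addNKr scalerA -scaleNr mulNr.
  have -> : b - x = (1 - s / tau) *: (b - a).
    by rewrite xE opprD addrA scalerA scalerBl scale1r.
  exact: mnZ.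
(* All the lines L_x pass through the point common to L_a and L_b. *)
have main x : `|x - p| < tau * (d / 2) -> mn (a - x) (b - x) != 0 ->
    forall wx, pole_at Delta (G x) wx ->
    \rank (LA :&: LB)%MS = 1%N /\ (LA :&: LB <= pole_line (G x - P) wx)%MS.
  move=> xp xmn wx px; have xd := small _ xp; have [da db] := dir _ xp.
  have [VX fX] := fG _ xd.
  have [gxa [Dxa sxa Jxa]] := J _ _ xd da.
  have [gxb [Dxb sxb Jxb]] := J _ _ xd db.
  have gxaX : gxa (G x) by move: (Jxa 0); rewrite scale0r addr0; apply.
  have gxbX : gxb (G x) by move: (Jxb 0); rewrite scale0r addr0; apply.
  have gxaA : gxa (G a).
    by move: (Jxa tau); rewrite go//; apply.
  have gxbB : gxb (G b).
    by move: (Jxb (2 * tau)); rewrite go ?mulf_neq0//; apply.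
  have [pxa [rxa inxa onxa]] := plane_of_circle P Dc Dxa.
  have [pxb [rxb inxb onxb]] := plane_of_circle P Dc Dxb.
  apply: (concurrent_lines (pAB := pab) (pAX := pxa) (pBX := pxb)) => //;
    try exact: rank_pole_line.
  - exact: inab.
  - exact: inab.
  - exact: inxa.
  - exact: inxa.
  - exact: inxb.
  - exact: inxb.
  - by apply/negP => /pole_line_point /onab; exact: not_ab.
  - apply/negP => /pole_line_point /onxa gB; have [s] := sxa _ gB Vb; rewrite fb => bE.
    move/eqP: xmn; apply.
    have -> : b - x = (s / tau) *: (a - x) by rewrite bE addrC addKr scalerA.
    by rewrite -[a - x]scale1r scalerA mulr1; exact: mnZ.
have [pp pmn] := nbhs_singleton near_p.
have pd : `|p - p| < d by exact: small.
have [w Pw] := pole _ pd.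
have [rO OP] := main p pp pmn w Pw.
pose O := nz_row (LA :&: LB)%MS.
have O0 : O != 0 by rewrite nz_row_eq0 -mxrank_eq0 rO.
have OL : (O <= LA :&: LB)%MS by exact: nz_row_sub.
have OP' : (O <= pole_line 0 w)%MS.
  by apply: submx_trans OL _; move: OP; rewrite GP subrr.
have [[al be] OE] : exists z : R * R, O = point5 (z.2 * 2) (z.2 *: w) z.1.
  have /submxP[z zE] := OP'.
  exists (lsubmx (z : 'rV_(1 + 1)) 0 0, rsubmx (z : 'rV_(1 + 1)) 0 0) => /=.
  rewrite zE -[z in LHS](@hsubmxK _ 1 1 1) mul_row_col.
  rewrite [lsubmx _ in LHS]mx11_scalar [rsubmx _ in LHS]mx11_scalar.
  rewrite !mul_scalar_mx !point5Z point5D !dot0l !mulr0 !addr0 scaler0 !add0r.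
  by rewrite mulr1.
(* Otherwise O is the lift of P, which would lie on the circle through a and b. *)
have be0 : be != 0.
  apply/eqP => be0; apply: (not_ab p pd pmn); apply: onab.
  rewrite GP subrr dot0l.
  have al0 : al != 0.
    by apply: contra_neq O0 => al0; rewrite OE /= be0 al0 mul0r scale0r /point5 !raddf0 !row_mx0.
  have -> : point5 0 0 1 = al^-1 *: O.
    by rewrite OE /= be0 point5Z mul0r scale0r mulr0 scaler0 mulVf.
  apply: scalemx_sub; apply: submx_trans OL _; apply: submx_trans (capmxSl _ _) _.
  exact: inab.
exists w, (al / be).
have fc : {for P, continuous f} by exact/differentiable_continuous/(rect_diff rectV).
have nearP : \forall Q \near P, V Q by apply: open_nbhs_nbhs; split => //; case: rectV.
have nearfP : \forall Q \near P, `|f Q - p| < tau * (d / 2) /\ mn (a - f Q) (b - f Q) != 0.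
  exact: (fc _ near_p).
apply: filterS2 nearP nearfP => Q VQ [Qp Qmn] c n r n0 r0 Dg gQ.
have GQ : G (f Q) = Q by case: rectV => _ _ _ _; apply.
have [wQ pQ] := pole _ (small _ Qp).
have [_] := main _ Qp Qmn _ pQ; rewrite GQ in pQ *.
have [nw cw] := pQ c n r n0 r0 Dg gQ; case: gQ => Qn Qr.
move=> OQ; have := submx_trans OL (submx_trans OQ (pole_line_sub_circle P Qn Qr nw cw)).
rewrite OE /= => /point5_circle; rewrite !dotZl => -[h1 h2].
split; apply: (mulfI be0).
  by rewrite dotC h1 mulrA mulrCA divff// mulr1 (dotC n).
have beal : be * (al / be) = al by rewrite mulrC divfK.
by rewrite [LHS]mulrDr [be * (_ * _)]mulrA beal (dotC _ w); lra.
Qed.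
End CommonPoint.

(** * Smooth functions *)

Section SmoothFunctions.
Variables (R : realType).

Lemma near_eq_differentiable (V W : normedModType R) (f g : V -> W) (a : V) :
  (\forall x \near a, f x = g x) -> differentiable f a -> differentiable g a.
Proof.
move=> fg df; have /diff_locallyP[dc fE] := df.
have ga := nbhs_singleton fg.
have gE : g \o shift a = cst (g a) + 'd f a +o_ 0 id.
  apply/eqaddoP => e e0; move/eqaddoP : fE => /(_ e e0).
  have fg0 : \forall h \near (0 : V), f (h + a) = g (h + a).
    have c : h + a @[h --> (0 : V)] --> a.
      by rewrite -[X in _ --> X]add0r; apply: cvgD; [exact: cvg_id|exact: cvg_cst].
    exact: (c _ fg).
  by apply: filterS2 fg0 => h fgh; rewrite !fctE /= fgh ga.
have dE := diff_unique dc gE.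
by apply/diff_locallyP; rewrite dE.
Qed.

Variable p : nat.
Implicit Types (U : set 'rV[R]_p.+1).

(** The analogue of [class_C] for maps into any normed module, so as to include
    real functions. *)
Fixpoint smooth_upto (W : normedModType R) (n : nat) U (h : 'rV[R]_p.+1 -> W) : Prop :=
  match n with
  | 0%N => forall x, U x -> {for x, continuous h}
  | m.+1 => (forall x, U x -> differentiable h x) /\
            (forall v, smooth_upto m U (fun x => 'D_v h x))
  end.

(** Derivatives are given by the usual rules on U only, so smoothness has to be
    insensitive to values outside of the open set U. *)
Lemma smooth_upto_ext (W : normedModType R) n U (h k : 'rV[R]_p.+1 -> W) : open U ->
  (forall x, U x -> h x = k x) -> smooth_upto n U h -> smooth_upto n U k.
Proof.
move=> Uo; have near_hk (h1 h2 : 'rV[R]_p.+1 -> W) : (forall x, U x -> h1 x = h2 x) ->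
    forall x, U x -> \forall y \near x, h1 y = h2 y.
  by move=> hk x Ux; apply: filterS (open_nbhs_nbhs (conj Uo Ux)) => y; exact: hk.
elim: n h k => [|n IHn] h k hk /=.
  move=> hc x Ux; have hkx := near_hk _ _ hk _ Ux.
  have hx : h y @[y --> x] --> h x by exact: hc.
  rewrite (hk _ Ux) in hx; apply: cvg_trans hx.
  exact: (near_eq_cvg hkx).
move=> [dh ch]; split => [x Ux|v].
  by apply: near_eq_differentiable (dh _ Ux); exact: near_hk.
by apply: IHn (ch v) => x Ux; apply: near_eq_derive; exact: near_hk.
Qed.

Lemma smooth_upto_sub (W : normedModType R) n U U' (h : 'rV[R]_p.+1 -> W) :
  U' `<=` U -> smooth_upto n U h -> smooth_upto n U' h.
Proof.
move=> UU; elim: n h => [|n IHn] h /= H; first by move=> x /UU; exact: H.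
by case: H => H1 H2; split => [x /UU /H1//|v]; exact: IHn.
Qed.

Lemma smooth_uptoW (W : normedModType R) n U (h : 'rV[R]_p.+1 -> W) :
  smooth_upto n.+1 U h -> smooth_upto n U h.
Proof.
elim: n h => [|n IHn] h [dh ch] /=; first by move=> x /dh /differentiable_continuous.
by split => // v; exact: IHn.
Qed.

Lemma smooth_upto_cst (W : normedModType R) n U (a : W) : open U ->
  smooth_upto n U (fun=> a).
Proof.
move=> Uo; elim: n a => [|n IHn] a /=; first by move=> x _; exact: cst_continuous.
split=> [x _|v]; first exact: differentiable_cst.
by apply: smooth_upto_ext (IHn 0) => // x _; rewrite derive_cst.
Qed.

Lemma smooth_uptoD (W : normedModType R) n U (h k : 'rV[R]_p.+1 -> W) : open U ->
  smooth_upto n U h -> smooth_upto n U k -> smooth_upto n U (fun x => h x + k x).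
Proof.
move=> Uo; elim: n h k => [|n IHn] h k /=.
  by move=> hc kc x Ux; apply: continuousD; [exact: hc|exact: kc].
move=> [dh ch] [dk ck]; split=> [x Ux|v].
  by apply: differentiableD; [exact: dh|exact: dk].
apply: smooth_upto_ext (IHn _ _ (ch v) (ck v)) => // x Ux.
by rewrite deriveD//; apply: diff_derivable; [exact: dh|exact: dk].
Qed.

Lemma smooth_uptoM n U (h k : 'rV[R]_p.+1 -> R) : open U ->
  smooth_upto n U h -> smooth_upto n U k -> smooth_upto n U (fun x => h x * k x).
Proof.
move=> Uo; elim: n h k => [|n IHn] h k.
  by move=> hc kc x Ux; apply: continuousM; [exact: hc|exact: kc].
move=> sh sk; have [/= dh ch] := sh; have [/= dk ck] := sk; split=> [x Ux|v].
  by apply: differentiableM; [exact: dh|exact: dk].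
apply: smooth_upto_ext (smooth_uptoD Uo (IHn _ _ (smooth_uptoW sh) (ck v))
  (IHn _ _ (smooth_uptoW sk) (ch v))) => // x Ux.
by rewrite deriveM//; apply: diff_derivable; [exact: dh|exact: dk].
Qed.

Lemma smooth_uptoV n U (h : 'rV[R]_p.+1 -> R) : open U -> (forall x, U x -> h x != 0) ->
  smooth_upto n U h -> smooth_upto n U (fun x => (h x)^-1).
Proof.
move=> Uo h0; elim: n => [|n IHn].
  by move=> hc x Ux; apply: continuousV; [exact: h0|exact: hc].
move=> sh; have [/= dh ch] := sh; split=> [x Ux|v].
  by apply: differentiableV; [exact: dh|exact: h0].
have sV := IHn (smooth_uptoW sh).
have sN : smooth_upto n U (fun x => - 1 * ((h x)^-1 * (h x)^-1) * 'D_v h x).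
  have s1 := @smooth_upto_cst R^o n U (- 1) Uo.
  exact: smooth_uptoM Uo (smooth_uptoM Uo s1 (smooth_uptoM Uo sV sV)) (ch v).
apply: smooth_upto_ext sN => // x Ux.
rewrite deriveV ?h0//; last by apply: diff_derivable; exact: dh.
by rewrite mulN1r -expr2 exprVn.
Qed.

Lemma smooth_upto_sqrt n U (h : 'rV[R]_p.+1 -> R) : open U -> (forall x, U x -> 0 < h x) ->
  smooth_upto n U h -> smooth_upto n U (fun x => Num.sqrt (h x)).
Proof.
move=> Uo h0; elim: n => [|n IHn].
  move=> hc x Ux; apply: (@continuous_comp _ _ _ h Num.sqrt); first exact: hc.
  exact: sqrt_continuous.
move=> sh; have [/= dh ch] := sh.
have dsq x : U x -> differentiable Num.sqrt (h x).
  by move=> Ux; apply/derivable1_diffP; case: (is_derive1_sqrt (h0 _ Ux)).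
split=> [x Ux|v].
  by apply: (@differentiable_comp _ _ _ _ h Num.sqrt); [exact: dh|exact: dsq].
have sS := IHn (smooth_uptoW sh).
have s2 : smooth_upto n U (fun x => 2 * Num.sqrt (h x)).
  by apply: smooth_uptoM => //; exact: smooth_upto_cst.
have sV : smooth_upto n U (fun x => (2 * Num.sqrt (h x))^-1).
  apply: smooth_uptoV => // x Ux.
  by rewrite mulf_neq0// gt_eqF// sqrtr_gt0 h0.
apply: smooth_upto_ext (smooth_uptoM Uo sV (ch v)) => // x Ux.
have dhx := dh _ Ux; have dsx := dsq _ Ux.
have dsh : differentiable (Num.sqrt \o h) x by exact: differentiable_comp.
transitivity ('D_v (Num.sqrt \o h) x); last by [].
rewrite (deriveE _ dsh).
have -> : 'd (Num.sqrt \o h) x v = 'd Num.sqrt (h x) ('d h x v).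
  exact: (congr1 (fun F : _ -> R => F v) (diff_comp dhx dsx)).
rewrite -(deriveE _ dhx) -[X in 'd Num.sqrt (h x) X]mulr1 [RHS]linearZ/=.
rewrite -(deriveE _ dsx) derive_sqrt ?h0//.
exact: mulrC.
Qed.

Lemma smooth_upto_coord n U i : open U -> smooth_upto n U (fun x : 'rV[R]_p.+1 => x 0 i).
Proof.
move=> Uo; case: n => [|n]; first by move=> x _; exact: coord_continuous.
split=> [x _|v]; first exact: differentiable_coord.
apply: smooth_upto_ext (smooth_upto_cst n (v 0 i) Uo) => // x _.
have d : derivable (id : 'rV[R]_p.+1 -> 'rV[R]_p.+1) x v by exact: derivable_id.
have := derive_mx d; rewrite derive_id => /rowP/(_ i); rewrite mxE => ->.
by [].
Qed.

Lemma smooth_upto_vector n U q (h : 'rV[R]_p.+1 -> 'rV[R]_q.+1) : open U ->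
  (forall i, smooth_upto n U (fun x => h x 0 i)) -> class_C n U h.
Proof.
move=> Uo; elim: n h => [|n IHn] h sh.
  move=> x Ux; have hE : h = (fun y => \sum_i h y 0 i *: delta_mx 0 i).
    by apply/funext => y; exact: row_sum_delta.
  have : (fun y => \sum_i h y 0 i *: delta_mx 0 i) @ nbhs x -->
      \sum_i h x 0 i *: (delta_mx 0 i : 'rV[R]_q.+1).
    apply: cvg_big => [|i _]; first exact: add_continuous.
    by apply: cvgZ; [exact: sh|exact: cvg_cst].
  by rewrite -hE -row_sum_delta.
have dh x : U x -> differentiable h x.
  move=> Ux; have -> : h = \sum_i (fun y => h y 0 i *: delta_mx 0 i).
    by apply/funext => y; rewrite fct_sumE; exact: row_sum_delta.
  by apply: differentiable_sum => i; apply: differentiableZl; exact: (sh i).1.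
split=> // v; apply: IHn => i.
apply: smooth_upto_ext ((sh i).2 v) => // x Ux.
by rewrite derive_mx ?mxE//; apply: diff_derivable; exact: dh.
Qed.

End SmoothFunctions.

Section CoordSmooth.
Variables (R : realType) (p : nat) (n : nat) (U : set 'rV[R]_p.+1).
Hypothesis Uo : open U.

Definition coord_smooth q (F : 'rV[R]_p.+1 -> 'rV[R]_q) :=
  forall i, smooth_upto n U (fun x => F x 0 i).

Lemma coord_smooth_cst q (a : 'rV[R]_q) : coord_smooth (fun=> a).
Proof. by move=> i; exact: smooth_upto_cst. Qed.

Lemma coord_smooth_id : coord_smooth (fun x => x).
Proof. by move=> i; exact: smooth_upto_coord. Qed.

Lemma coord_smoothD q (F G : 'rV[R]_p.+1 -> 'rV[R]_q) :
  coord_smooth F -> coord_smooth G -> coord_smooth (fun x => F x + G x).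
Proof.
move=> hF hG i; apply: smooth_upto_ext (smooth_uptoD Uo (hF i) (hG i)) => // x _.
by rewrite mxE.
Qed.

Lemma coord_smoothZ q (a : 'rV[R]_p.+1 -> R) (F : 'rV[R]_p.+1 -> 'rV[R]_q) :
  smooth_upto n U a -> coord_smooth F -> coord_smooth (fun x => a x *: F x).
Proof.
move=> ha hF i; apply: smooth_upto_ext (smooth_uptoM Uo ha (hF i)) => // x _.
by rewrite mxE.
Qed.

Lemma smooth_upto_const (a : R) : smooth_upto n U (fun=> a).
Proof. exact: (@smooth_upto_cst _ _ R^o). Qed.

Lemma coord_smoothN q (F : 'rV[R]_p.+1 -> 'rV[R]_q) :
  coord_smooth F -> coord_smooth (fun x => - F x).
Proof.
move=> hF i.
apply: smooth_upto_ext (smooth_uptoM Uo (smooth_upto_const (-1)) (hF i)) => // x _.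
by rewrite mxE mulN1r.
Qed.

Lemma smooth_uptoN (a : 'rV[R]_p.+1 -> R) :
  smooth_upto n U a -> smooth_upto n U (fun x => - a x).
Proof.
move=> ha; apply: smooth_upto_ext (smooth_uptoM Uo (smooth_upto_const (-1)) ha) => // x _.
by rewrite mulN1r.
Qed.

Lemma smooth_upto_dot (F G : 'rV[R]_p.+1 -> 'rV[R]_3) :
  coord_smooth F -> coord_smooth G -> smooth_upto n U (fun x => dot (F x) (G x)).
Proof.
move=> hF hG.
apply: smooth_upto_ext (smooth_uptoD Uo (smooth_uptoD Uo (smooth_uptoM Uo (hF 0) (hG 0))
  (smooth_uptoM Uo (hF 1) (hG 1))) (smooth_uptoM Uo (hF 2) (hG 2))) => // x _.
by rewrite dot3.
Qed.

End CoordSmooth.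

Lemma open_pos (R : realType) p (U : set 'rV[R]_p.+1) (h : 'rV[R]_p.+1 -> R) : open U ->
  smooth_upto 0 U h -> open (U `&` [set x | 0 < h x]).
Proof.
move=> Uo hc; rewrite openE => x [Ux hx].
have n1 : \forall y \near x, U y by exact: open_nbhs_nbhs.
have n2 : \forall y \near x, 0 < h y.
  have c : h y @[y --> x] --> h x by exact: hc.
  exact: (cvgr_gt _ c).
exact: filterS2 n1 n2.
Qed.

(** * The projection in affine coordinates and its inverse *)

Section SmallRoot.
Variable R : rcfType.

(** Here s is the smaller root of a s^2 - b s + c. Writing it with the square root
    in the denominator keeps the formula valid for a = 0 and smooth in a. *)
Lemma small_root (s a b c : R) : 0 <= s -> 0 <= a -> c = s * (b - s * a) ->
  0 < b - 2 * (s * a) ->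
  [/\ 0 < b, 0 < b ^+ 2 - 4 * a * c & 2 * c * (b + Num.sqrt (b ^+ 2 - 4 * a * c))^-1 = s].
Proof.
move=> s0 a0 -> h; have sa : 0 <= s * a by exact: mulr_ge0.
have -> : b ^+ 2 - 4 * a * (s * (b - s * a)) = (b - 2 * (s * a)) ^+ 2 by ring.
split; [lra | by rewrite exprn_gt0 |].
rewrite sqrtr_sqr gtr0_norm//; field; rewrite gt_eqF//; lra.
Qed.

Lemma small_root_eq (a b c : R) : 0 < b -> 0 < b ^+ 2 - 4 * a * c ->
  let s := 2 * c * (b + Num.sqrt (b ^+ 2 - 4 * a * c))^-1 in
  s = c + s * (1 - b) + s ^+ 2 * a /\ 0 < b - 2 * (s * a).
Proof.
move=> b0 q0; have := sqr_sqrtr (ltW q0); have : 0 < Num.sqrt (b ^+ 2 - 4 * a * c) by rewrite sqrtr_gt0.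
move: (Num.sqrt _) => r r0 rE /=; have br : b + r != 0 by rewrite gt_eqF// addr_gt0.
have cE : 4 * a * c = (b - r) * (b + r) by rewrite -subr_sqr rE; ring.
split.
  apply/eqP; rewrite -subr_eq0; apply/eqP.
  transitivity (- (c / (b + r) ^+ 2) * (4 * a * c - (b - r) * (b + r))); first by field.
  by rewrite cE subrr mulr0.
have -> : b - 2 * (2 * c * (b + r)^-1 * a) = b - (4 * a * c) / (b + r) by field.
by rewrite cE mulfK// subKr.
Qed.

End SmallRoot.

Section SphereChart.
Variables (R : realType) (P w : 'rV[R]_3) (beta : R).

(** The projection of RP^4 from the point (1, w, beta), composed with the lift and
    read in an affine chart. *)
Definition sphere_chart (X : 'rV[R]_3) : 'rV[R]_3 :=
  (1 - beta * dot (X - P) (X - P))^-1 *: (X - P - dot (X - P) (X - P) *: w).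

(** If eta = [sphere_chart] X, then X - P = eta + s k with s = |X - P|^2 and
    k = [chart_axis] eta. Taking squared norms, s is a root of the polynomial
    |k|^2 s^2 - b s + |eta|^2 with b = [chart_lin] eta. *)
Definition chart_axis (eta : 'rV[R]_3) : 'rV[R]_3 := w - beta *: eta.

Definition chart_lin eta : R := 1 - 2 * dot eta (chart_axis eta).

Definition chart_disc eta : R :=
  chart_lin eta ^+ 2 - 4 * dot (chart_axis eta) (chart_axis eta) * dot eta eta.

Definition chart_sqdist eta : R :=
  2 * dot eta eta * (chart_lin eta + Num.sqrt (chart_disc eta))^-1.

Definition sphere_chart_inv (eta : 'rV[R]_3) : 'rV[R]_3 :=
  P + (eta + chart_sqdist eta *: chart_axis eta).

(** The second inequality selects the points X for which |X - P|^2 is the smaller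
    root of the quadratic equation above. *)
Definition sphere_chart_dom : set 'rV[R]_3 :=
  [set X | 0 < 1 - beta * dot (X - P) (X - P)] `&`
  [set X | 0 < chart_lin (sphere_chart X) - 2 * (dot (X - P) (X - P) *
     dot (chart_axis (sphere_chart X)) (chart_axis (sphere_chart X)))].

(** An intersection of successive half-space conditions starting from the whole
    space, each function being smooth where the preceding ones are positive. *)
Definition sphere_chart_img : set 'rV[R]_3 :=
  ([set: 'rV[R]_3] `&` [set eta | 0 < chart_lin eta] `&` [set eta | 0 < chart_disc eta])
  `&` [set eta | 0 < 1 - beta * chart_sqdist eta].

Lemma sphere_chart_dom_base : sphere_chart_dom P.
Proof.
split; rewrite /= subrr dot0l; first by rewrite mulr0 subr0.
rewrite mul0r mulr0 subr0.
by rewrite /chart_lin /sphere_chart subrr dot0l scale0r subr0 scaler0 dot0l mulr0 subr0.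
Qed.

Lemma dot_add_axis (eta k : 'rV[R]_3) (t : R) :
  dot (eta + t *: k) (eta + t *: k) =
  dot eta eta + t * (2 * dot eta k) + t ^+ 2 * dot k k.
Proof. by rewrite !dotE (dotC k eta); ring. Qed.

Lemma sphere_chartK X : sphere_chart_dom X ->
  sphere_chart_img (sphere_chart X) /\ sphere_chart_inv (sphere_chart X) = X.
Proof.
move=> [/= dX bX].
have YE : X - P = sphere_chart X + dot (X - P) (X - P) *: chart_axis (sphere_chart X).
  have : (1 - beta * dot (X - P) (X - P)) *: sphere_chart X = X - P - dot (X - P) (X - P) *: w.
    by rewrite /sphere_chart scalerA divff ?scale1r// gt_eqF.
  rewrite /chart_axis; move: (sphere_chart X) (dot _ _) => eta s h.
  by apply/rowP => i; move/rowP: h => /(_ i); rewrite !mxE; lra.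
have sE := dot_add_axis (sphere_chart X) (chart_axis (sphere_chart X)) (dot (X - P) (X - P)).
rewrite -YE in sE.
have [||||b0 q0 rE] := @small_root R (dot (X - P) (X - P))
  (dot (chart_axis (sphere_chart X)) (chart_axis (sphere_chart X)))
  (chart_lin (sphere_chart X)) (dot (sphere_chart X) (sphere_chart X)).
- exact: dot_ge0.
- exact: dot_ge0.
- by rewrite /chart_lin; lra.
- by [].
split; last by rewrite /sphere_chart_inv /chart_sqdist rE -YE addrC subrK.
by split; [split; [split|]|rewrite /= /chart_sqdist rE].
Qed.

Lemma sphere_chart_invK eta : sphere_chart_img eta ->
  sphere_chart_dom (sphere_chart_inv eta) /\ sphere_chart (sphere_chart_inv eta) = eta.
Proof.
move=> [[[_ b0] q0] d0].
have [sE s0] := small_root_eq b0 q0; rewrite -/(chart_sqdist eta) in sE s0 d0.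
have PE : sphere_chart_inv eta - P = eta + chart_sqdist eta *: chart_axis eta.
  by rewrite /sphere_chart_inv addrC addKr.
have YE : dot (sphere_chart_inv eta - P) (sphere_chart_inv eta - P) = chart_sqdist eta.
  by rewrite PE dot_add_axis {3}sE /chart_lin; ring.
have cE : sphere_chart (sphere_chart_inv eta) = eta.
  rewrite /sphere_chart YE PE /chart_axis.
  have dn : 1 - beta * chart_sqdist eta != 0 by rewrite gt_eqF.
  by apply/rowP => i; rewrite !mxE; field.
by split=> //; split; rewrite /= ?cE YE.
Qed.

End SphereChart.

Section SphereChartSmooth.
Variables (R : realType) (P w : 'rV[R]_3) (beta : R).

Let D0 := [set: 'rV[R]_3] `&` [set X | 0 < 1 - beta * dot (X - P) (X - P)].
Let N0 := [set: 'rV[R]_3] `&` [set eta | 0 < chart_lin w beta eta].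
Let N1 := N0 `&` [set eta | 0 < chart_disc w beta eta].

Let smooth_sqdist n (U : set 'rV[R]_3) : open U ->
  smooth_upto n U (fun X : 'rV[R]_3 => dot (X - P) (X - P)).
Proof.
move=> Uo; have hY : coord_smooth n U (fun X : 'rV[R]_3 => X - P).
  by apply: coord_smoothD => //; [exact: coord_smooth_id|exact: coord_smooth_cst].
exact: smooth_upto_dot.
Qed.

Let smooth_den n (U : set 'rV[R]_3) : open U ->
  smooth_upto n U (fun X : 'rV[R]_3 => 1 - beta * dot (X - P) (X - P)).
Proof.
move=> Uo; apply: smooth_uptoD => //; first exact: smooth_upto_const.
apply: smooth_uptoN => //; apply: smooth_uptoM => //; first exact: smooth_upto_const.
exact: smooth_sqdist.
Qed.

Let D0o : open D0.
Proof. by apply: open_pos; [exact: openT|apply: smooth_den; exact: openT]. Qed.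

Let smooth_chart n : coord_smooth n D0 (sphere_chart P w beta).
Proof.
apply: coord_smoothZ => //.
  apply: smooth_uptoV => //; last exact: smooth_den.
  by move=> x [_ /= h]; rewrite gt_eqF.
apply: coord_smoothD => //.
  by apply: coord_smoothD => //; [exact: coord_smooth_id|exact: coord_smooth_cst].
apply: coord_smoothN => //; apply: coord_smoothZ => //; last exact: coord_smooth_cst.
exact: smooth_sqdist.
Qed.

Let smooth_axis n (U : set 'rV[R]_3) : open U -> coord_smooth n U (chart_axis w beta).
Proof.
move=> Uo; apply: coord_smoothD => //; first exact: coord_smooth_cst.
apply: coord_smoothN => //; apply: coord_smoothZ => //; last exact: coord_smooth_id.
exact: smooth_upto_const.
Qed.

Let smooth_lin n (U : set 'rV[R]_3) : open U -> smooth_upto n U (chart_lin w beta).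
Proof.
move=> Uo; apply: smooth_uptoD => //; first exact: smooth_upto_const.
apply: smooth_uptoN => //; apply: smooth_uptoM => //; first exact: smooth_upto_const.
by apply: smooth_upto_dot => //; [exact: coord_smooth_id|exact: smooth_axis].
Qed.

Let smooth_disc n (U : set 'rV[R]_3) : open U -> smooth_upto n U (chart_disc w beta).
Proof.
move=> Uo; apply: smooth_uptoD => //; first by apply: smooth_uptoM => //; exact: smooth_lin.
apply: smooth_uptoN => //; apply: smooth_uptoM => //.
  apply: smooth_uptoM => //; first exact: smooth_upto_const.
  by apply: smooth_upto_dot => //; exact: smooth_axis.
by apply: smooth_upto_dot => //; exact: coord_smooth_id.
Qed.

Let N0o : open N0.
Proof. by apply: open_pos; [exact: openT|apply: smooth_lin; exact: openT]. Qed.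

Let N1o : open N1.
Proof. by apply: open_pos => //; exact: smooth_disc. Qed.

Let smooth_root n : smooth_upto n N1 (chart_sqdist w beta).
Proof.
apply: smooth_uptoM => //.
  apply: smooth_uptoM => //; first exact: smooth_upto_const.
  by apply: smooth_upto_dot => //; exact: coord_smooth_id.
apply: smooth_uptoV => //.
  by move=> x [[_ /= h1] /= h2]; rewrite gt_eqF// addr_gt0// sqrtr_gt0.
apply: smooth_uptoD => //; first exact: smooth_lin.
by apply: smooth_upto_sqrt => //; [move=> x []|exact: smooth_disc].
Qed.

Let smooth_inv n : coord_smooth n N1 (sphere_chart_inv P w beta).
Proof.
apply: coord_smoothD => //; first exact: coord_smooth_cst.
apply: coord_smoothD => //; first exact: coord_smooth_id.
by apply: coord_smoothZ => //; exact: smooth_axis.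
Qed.

Lemma open_sphere_chart_dom : open (sphere_chart_dom P w beta).
Proof.
have -> : sphere_chart_dom P w beta = D0 `&` [set X | 0 <
    chart_lin w beta (sphere_chart P w beta X) - 2 * (dot (X - P) (X - P) *
     dot (chart_axis w beta (sphere_chart P w beta X)) (chart_axis w beta (sphere_chart P w beta X)))].
  by rewrite /D0 setTI.
apply: open_pos => //.
have hk : coord_smooth 0 D0 (fun X => chart_axis w beta (sphere_chart P w beta X)).
  apply: coord_smoothD => //; first exact: coord_smooth_cst.
  apply: coord_smoothN => //; apply: coord_smoothZ => //; exact: smooth_upto_const.
apply: smooth_uptoD => //.
  apply: smooth_uptoD => //; first exact: smooth_upto_const.
  apply: smooth_uptoN => //; apply: smooth_uptoM => //; first exact: smooth_upto_const.
  exact: smooth_upto_dot.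
apply: smooth_uptoN => //; apply: smooth_uptoM => //; first exact: smooth_upto_const.
by apply: smooth_uptoM => //; [exact: smooth_sqdist|exact: smooth_upto_dot].
Qed.

Lemma open_sphere_chart_img : open (sphere_chart_img w beta).
Proof.
apply: open_pos => //; apply: smooth_uptoD => //; first exact: smooth_upto_const.
by apply: smooth_uptoN => //; apply: smooth_uptoM => //; exact: smooth_upto_const.
Qed.

Lemma sphere_chart_diffeo (W : set 'rV[R]_3) : open W -> W `<=` sphere_chart_dom P w beta ->
  diffeo_onto_image W (sphere_chart P w beta).
Proof.
move=> Wo Wdom.
have imE : sphere_chart P w beta @` W = [set eta | sphere_chart_img w beta eta /\
    W (sphere_chart_inv P w beta eta)].
  apply/seteqP; split => [_ [X WX <-]|eta [h WX]].
    by have [h1 h2] := sphere_chartK (Wdom _ WX); split => //; rewrite h2.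
  by exists (sphere_chart_inv P w beta eta) => //; exact: (sphere_chart_invK P h).2.
have imo : open (sphere_chart P w beta @` W).
  rewrite imE openE => eta [h Wh].
  have n1 : \forall z \near eta, sphere_chart_img w beta z.
    by apply: open_nbhs_nbhs; split => //; exact: open_sphere_chart_img.
  have c : {for eta, continuous (sphere_chart_inv P w beta)}.
    have [+ _] := smooth_upto_vector N1o (smooth_inv 1); move/(_ eta h.1).
    exact: differentiable_continuous.
  have n2 : \forall z \near eta, W (sphere_chart_inv P w beta z).
    by apply: (c W); exact: open_nbhs_nbhs.
  exact: filterS2 n1 n2.
split => //.
- move=> n; apply: smooth_upto_vector => // i; apply: smooth_upto_sub (smooth_chart n i).
  by move=> X /Wdom[]; split.
- exists (sphere_chart_inv P w beta); split; last first.
    by move=> X /Wdom /sphere_chartK[].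
  move=> n; apply: smooth_upto_vector => // i; apply: smooth_upto_sub (smooth_inv n i).
  by rewrite imE => eta [[]].
Qed.

End SphereChartSmooth.

(** * The projection as a map to RP^3 *)

Section ProjectiveSpace.
Variable R : realType.

Lemma vpick_vline (S : 'rV[R]_4) : S != 0 ->
  exists2 t : R, t != 0 & vpick <[S]>%VS = t *: S.
Proof.
move=> S0; have /vlineP[t tE] := memv_pick <[S]>%VS.
exists t => //; apply: contra_neq S0 => t0.
by move/eqP: tE; rewrite t0 scale0r vpick0 -dimv_eq0 dim_vline eqb0 negbK => /eqP.
Qed.

Lemma chart_vline (j : 'I_4) (S : 'rV[R]_4) : S 0 j != 0 ->
  chart_dom j <[S]>%VS /\ chart j <[S]>%VS = \row_i (S 0 (lift j i) / S 0 j).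
Proof.
move=> Sj; have S0 : S != 0 by apply: contra_neq Sj => ->; rewrite mxE.
have [t t0 tE] := vpick_vline S0; split.
  by split; rewrite /rp3_point ?dim_vline ?S0// tE mxE mulf_neq0.
by apply/rowP => i; rewrite !mxE tE !mxE -mulf_div divff// mul1r.
Qed.

(** Homogeneous coordinates of the projection of the lift of X. *)
Definition sphere_row (P w : 'rV[R]_3) (beta : R) (X : 'rV[R]_3) : 'rV[R]_(3 + 1) :=
  row_mx (X - P - dot (X - P) (X - P) *: w) (1 - beta * dot (X - P) (X - P))%:M.

Lemma lift_max4 (i : 'I_3) : lift (ord_max : 'I_4) i = lshift 1 i :> 'I_4.
Proof. by apply/val_inj; rewrite /= /bump leqNgt ltn_ord. Qed.

Lemma ord_max4 : (ord_max : 'I_4) = rshift 3 (0 : 'I_1) :> 'I_4.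
Proof. exact/val_inj. Qed.

Lemma sphere_row_lift P w beta X (i : 'I_3) :
  (sphere_row P w beta X : 'rV[R]_4) 0 (lift ord_max i) =
  (X - P - dot (X - P) (X - P) *: w) 0 i.
Proof. by rewrite lift_max4 [LHS]row_mxEl. Qed.

Lemma sphere_row_max P w beta X :
  (sphere_row P w beta X : 'rV[R]_4) 0 ord_max = 1 - beta * dot (X - P) (X - P).
Proof. by rewrite ord_max4 [LHS]row_mxEr mxE eqxx mulr1n. Qed.

Lemma sphere_mapE (P w : 'rV[R]_3) (beta : R) : exists a b c d e : 'I_4 -> R,
  forall X, sphere_map a b c d e X = <[sphere_row P w beta X : 'rV[R]_4]>%VS.
Proof.
pose f (z : R) (v : 'I_3 -> R) (i : 'I_4) := if unlift ord_max i is Some k then v k else z.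
exists (f (- beta) (fun k => - w 0 k)).
exists (f (2 * beta * P 0 0) (fun k => (k == 0)%:R + 2 * w 0 k * P 0 0)).
exists (f (2 * beta * P 0 1) (fun k => (k == 1)%:R + 2 * w 0 k * P 0 1)).
exists (f (2 * beta * P 0 2) (fun k => (k == 2)%:R + 2 * w 0 k * P 0 2)).
exists (f (1 - beta * dot P P) (fun k => - P 0 k - w 0 k * dot P P)).
move=> X; rewrite /sphere_map; congr (<[_]>%VS); apply/rowP => i; rewrite mxE.
have [k ->|->] := unliftP ord_max i.
  rewrite sphere_row_lift /f liftK !coordE !dot3 !coordE.
  by case: (ord3P k) => -> /=; ring.
by rewrite sphere_row_max /f unlift_none !dot3 !coordE; ring.
Qed.

(** The forms of [circle_eqs] on the hyperplane s = 0, onto which RP^4 is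
    projected. *)
Definition line_eqs (n m : 'rV[R]_3) (rho : R) : 'M[R]_(3 + 1, 1 + 1) :=
  row_mx (col_mx n^T (- dot n m)%:M) (col_mx (- 2 *: m^T) rho%:M).

Lemma line_eqs_row (Y n m : 'rV[R]_3) rho t :
  (row_mx Y t%:M *m line_eqs n m rho == 0) =
  (dot Y n - t * dot n m == 0) && (- 2 * dot Y m + rho * t == 0).
Proof.
rewrite /line_eqs mul_mx_row !mul_row_col -scalemxAr !mulmx_tr_dot -!scalar_mxM.
rewrite scale_scalar_mx -!raddfD/= row_mx_eq0 !scalar_mx11_eq0.
by congr (_ && _); congr (_ == _); ring.
Qed.

Lemma rank_line_eqs (n m : 'rV[R]_3) rho r : n != 0 -> 0 < r -> rho = dot m m - r ^+ 2 ->
  row_full (line_eqs n m rho).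
Proof.
move=> n0 r0 rhoE; rewrite /row_full -mxrank_tr -[_ == _]/(row_free _).
apply: inj_row_free => v; rewrite -[v]hsubmxK /line_eqs tr_row_mx mul_row_col !tr_col_mx.
rewrite [lsubmx v]mx11_scalar [rsubmx v]mx11_scalar.
move: (lsubmx v 0 0) (rsubmx v 0 0) => a b.
rewrite !mul_scalar_mx !scale_row_mx add_row_mx trmxK linearZ/= trmxK !tr_scalar_mx.
rewrite !scale_scalar_mx -raddfD => /eqP.
rewrite row_mx_eq0 scalar_mx11_eq0 => /andP[/eqP hY /eqP ht].
have b0 : b = 0.
  have : dot (a *: n + b *: (-2 *: m)) m = 0 by rewrite hY dot0l.
  rewrite !dotE => hm; have : b * (dot m m + r ^+ 2) = 0 by move: ht hm; rewrite rhoE; lra.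
  move/eqP; rewrite mulf_eq0 => /orP[/eqP //|].
  by rewrite gt_eqF// ltr_wpDl ?dot_ge0// exprn_gt0.
move/eqP: hY; rewrite b0 scale0r addr0 scaler_eq0 (negPf n0) orbF => /eqP ->.
by rewrite raddf0 row_mx0.
Qed.

Lemma line_of_eqs (n m : 'rV[R]_3) rho r : n != 0 -> 0 < r -> rho = dot m m - r ^+ 2 ->
  exists l : {vspace 'rV[R]_4}, rp3_line l /\
    forall S : 'rV[R]_4, (<[S]> <= l)%VS = (S *m (line_eqs n m rho : 'M[R]_(4, 2)) == 0).
Proof.
move=> n0 r0 rhoE; have /row_fullP[B BN] := rank_line_eqs n0 r0 rhoE.
pose N : 'M[R]_(4, 2) := line_eqs n m rho.
pose h := linfun (mulmxr N : 'rV[R]_4 -> 'rV[R]_2).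
exists (lker h); split; last by move=> S; rewrite -memvE memv_ker lfunE.
have := limg_ker_dim h fullv; rewrite capfv dimvf /dim/= mul1n.
have -> : limg h = fullv.
  apply/vspaceP => y; rewrite memvf; apply/memv_imgP; exists (y *m (B : 'M[R]_(2, 4))).
    exact: memvf.
  by rewrite lfunE /= -mulmxA; rewrite [X in y *m X](BN : (B : 'M[R]_(2, 4)) *m N = 1%:M) mulmx1.
by rewrite dimvf /dim/= mul1n /rp3_line => /(@addIn 2 _ 2).
Qed.

End ProjectiveSpace.

Lemma class_CE (R : realType) p q n (U : set 'rV[R]_p.+1) (h : 'rV[R]_p.+1 -> 'rV[R]_q.+1) :
  class_C n U h <-> smooth_upto n U h.
Proof.
elim: n h => [|n IHn] h //=.
by split=> -[dh ch]; split => // v; apply/IHn.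
Qed.

Lemma diffeo_ext (R : realType) p (U : set 'rV[R]_p.+1) (h k : 'rV[R]_p.+1 -> 'rV[R]_p.+1) :
  (forall x, U x -> h x = k x) -> diffeo_onto_image U h -> diffeo_onto_image U k.
Proof.
move=> hk [Uo ho hs [g [gs gh]]].
have E : k @` U = h @` U.
  by apply/seteqP; split => _ [x Ux <-]; exists x => //; rewrite hk.
split => //; first by rewrite E.
  by move=> n; apply/class_CE; apply: smooth_upto_ext hk _ => //; apply/class_CE; exact: hs.
by exists g; rewrite E; split => // x Ux; rewrite -hk// gh.
Qed.

Lemma diffeo_jacobian (R : realType) p (U : set 'rV[R]_p.+1) (h : 'rV[R]_p.+1 -> 'rV[R]_p.+1) x :
  diffeo_onto_image U h -> U x -> \det (jacobian h x) != 0.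
Proof.
move=> [Uo ho hs [g [gs gh]]] Ux.
have dh : differentiable h x by exact: (hs 1%N).1.
have dg : differentiable g (h x) by apply: (gs 1%N).1; exists x.
suff : jacobian h x *m jacobian g (h x) = 1%:M.
  move/mulmx1_unit => [u _]; move: u; rewrite unitmxE unitfE.
  by [].
apply/row_matrixP => i; rewrite !rowE mulmx1 mulmxA -!deriveEjacobian//.
apply: derive_left_inverse => //.
by apply: filterS (open_nbhs_nbhs (conj Uo Ux)) => y; exact: gh.
Qed.

(** * Lines of RP^3 in an affine chart *)

Section Converse.
Variable R : realType.

(** The line l meets the hyperplane u_j = 0 in exactly one point, which gives the
    direction v of the affine line. *)
Lemma chart_of_line (j : 'I_4) (p0 l : {vspace 'rV[R]_4}) : rp3_line l ->
  chart_dom j p0 -> (p0 <= l)%VS ->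
  exists v : 'rV[R]_3, v != 0 /\ forall p, chart_dom j p -> (p <= l)%VS ->
    exists t : R, chart j p = chart j p0 + t *: v.
Proof.
move=> ldim [p0dim p0j] p0l.
pose u0 := vpick p0; have u0l : u0 \in l by apply: (subvP p0l); exact: memv_pick.
pose h := linfun (mulmxr (delta_mx j 0 : 'cV[R]_4) : 'rV[R]_4 -> 'rV[R]_1).
have hE u : (h u == 0) = (u 0 j == 0).
  rewrite lfunE /= -colE; apply/eqP/eqP => [/matrixP/(_ 0 0)|uj]; first by rewrite !mxE.
  by apply/rowP => i; rewrite ord1 !mxE.
have kdim : \dim (l :&: lker h)%VS = 1%N.
  have := limg_ker_dim h l; rewrite ldim.
  have h1 : (\dim (h @: l)%VS <= 1)%N.
    by apply: leq_trans (dimvS (subvf _)) _; rewrite dimvf /dim/= mul1n.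
  have h2 : (0 < \dim (h @: l)%VS)%N.
    rewrite lt0n dimv_eq0; apply: contraNneq p0j => hl.
    have : h u0 \in (h @: l)%VS by exact: memv_img.
    by rewrite hl memv0 hE.
  by case: (\dim (h @: l)%VS) h1 h2 => [//|[|//]] _ _; rewrite addn1 => -[].
pose v1 := vpick (l :&: lker h)%VS.
have v10 : v1 != 0 by rewrite vpick0 -dimv_eq0 kdim.
have kE : (l :&: lker h = <[v1]>)%VS.
  by apply/esym/eqP; rewrite eqEdim -memvE memv_pick kdim dim_vline v10.
have v1j : v1 0 j = 0.
  by apply/eqP; rewrite -hE -memv_ker; have := memv_pick (l :&: lker h)%VS; rewrite memv_cap => /andP[].
exists (\row_i v1 0 (lift j i)); split.
  apply: contra_neq v10 => /rowP v0; apply/rowP => k; rewrite mxE.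
  by have [i ->|->//] := unliftP j k; have := v0 i; rewrite !mxE.
move=> p [pdim pj] pl; set u := vpick p in pj *.
have ul : u \in l by apply: (subvP pl); exact: memv_pick.
have : u - (u 0 j / u0 0 j) *: u0 \in (l :&: lker h)%VS.
  rewrite memv_cap memvB ?memvZ//= memv_ker hE !mxE divfK ?subrr//.
rewrite kE => /vlineP[t tE]; exists (t / u 0 j).
have uE : u = (u 0 j / u0 0 j) *: u0 + t *: v1 by rewrite -tE addrC subrK.
apply/rowP => i; rewrite !mxE -/u -/u0 {1}uE !mxE.
by field; apply/andP.
Qed.
End Converse.

(** * The two implications *)

Lemma rectifiable_of_sphere_map (R : realType) (P : 'rV[R]_3) (Delta : set (set 'rV[R]_3))
    (F : 'rV[R]_3 -> {vspace 'rV[R]_4}) (W : set 'rV[R]_3) :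
  W P -> rp3_diffeo_onto_image W F ->
  (forall g, Delta g -> g `&` W !=set0 -> exists l : {vspace 'rV[R]_4}, rp3_line l /\
     g `&` W = [set X | W X /\ (F X <= l)%VS]) ->
  rectifiable_near P Delta.
Proof.
move=> WP [_ _ _ Fd] Fl; have [j [W' [W'P W'W dom diffeo]]] := Fd _ WP.
exists W', (fun Y => chart j (F Y)); split => //; first by case: diffeo.
move=> g Dg; have [gW|gW] := pselect (g `&` W' !=set0); last first.
  exists (range (fun t : R => 0 + t *: (delta_mx 0 0 : 'rV[R]_3))); split.
    exists 0, (delta_mx 0 0); split => //; apply/eqP => /rowP/(_ 0).
    by rewrite !mxE eqxx => /eqP; rewrite oner_eq0.
  by move=> Z [X [gX VX] _]; case: gW; exists X.
have [X0 [gX0 WX0]] := gW.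
have [|l [ldim gl]] := Fl g Dg; first by exists X0; split => //; exact: W'W.
have on_l X : g X -> W' X -> (F X <= l)%VS.
  move=> gX WX; have : (g `&` W) X by split => //; exact: W'W.
  by rewrite gl => -[].
have [v [v0 vE]] := chart_of_line ldim (dom _ WX0) (on_l _ gX0 WX0).
exists (range (fun t : R => chart j (F X0) + t *: v)); split; first by exists (chart j (F X0)), v.
move=> _ [X [gX WX] <-]; have [t ->] := vE _ (dom _ WX) (on_l _ gX WX).
by exists t.
Qed.

(** By continuity the cones at P and at the nearby points contain a common ball of
    directions. This feeds [projection_center], and the projection from the
    resulting point is the required map. *)
Lemma sphere_map_of_rectifiable (R : realType) (P : 'rV[R]_3) (U : set 'rV[R]_3)
    (Delta : set (set 'rV[R]_3)) : U P -> rich_family U Delta -> rectifiable_near P Delta ->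
  exists a b c d e : 'I_4 -> R,
    let Phi := sphere_map a b c d e in
    nonzero_jacobian Phi P /\
    exists W : set 'rV[R]_3,
      [/\ W P, rp3_diffeo_onto_image W Phi
        & forall g, Delta g -> g `&` W !=set0 ->
            exists l : {vspace 'rV[R]_4}, rp3_line l /\
              g `&` W = [set X | W X /\ (Phi X <= l)%VS]].
Proof.
move=> UP [Dc [Gamma [GD Gcov Gcone]]] [V [f [Vo VP [_ fVo fs [G [Gs Gf]]] fl]]].
have rectV : rectifier V f G by split.
have Dl g : Delta g -> exists A d, d != 0 /\ straightened V f g A d.
  move=> /fl[l [[A [d [d0 ->]]] gl]]; exists A, d; split => // X gX VX.
  by have [|t _ <-] := gl (f X); [exists X | exists t].
have [g0 [Gg0 g0P]] := Gcov _ UP.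
have [V0 [K [[V0o V0P _] Kc Ktan Kdir]]] := Gcone _ _ Gg0 UP g0P.
have [cm [dc [cm0 dc0 gc dcE]]] := circle_motion (Dc _ (GD _ Gg0)) g0P.
have KP : K P (dc 0).
  by apply: Ktan; split => //; exists cm; split => //; apply: filterE => t; exact: gc.
have [_ Kopen _] := Kc _ V0P.
have [[A B] /= [nA nB] AB] := Kopen _ KP.
have /nbhs_ballP[e /= e0 eB] := nB.
have rich : \forall Q \near P, forall u, `|u - dc 0| < e ->
    exists g, Delta g /\ g Q /\ tangent_direction g Q u.
  have n1 : \forall Q \near P, V0 Q by exact: open_nbhs_nbhs.
  apply: filterS2 n1 nA => Q VQ AQ u ue.
  have Bu : B u by apply: eB; rewrite -ball_normE /= distrC.
  have [g' [Gg' g'Q tg]] := Kdir _ _ VQ (AB (Q, u) (conj AQ Bu)).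
  by exists g'; split => //; exact: GD.
have [w [al near_w]] := projection_center rectV Dc Dl VP dc0 e0 rich.
pose w' : 'rV[R]_3 := 2^-1 *: w; pose be := al / 2.
have [a [b [c [d [e' PhiE]]]]] := sphere_mapE P w' be.
exists a, b, c, d, e'; set Phi := sphere_map a b c d e'.
pose W1 := (fun Q => forall (c n : 'rV[R]_3) (r : R), n != 0 -> 0 < r ->
    let g := [set X | dot (X - c) n = 0 /\ dot (X - c) (X - c) = r ^+ 2] in
    Delta g -> g Q ->
    dot n w = al * dot n (c - P) /\
    al * (dot (c - P) (c - P) - r ^+ 2) + 2 = 2 * dot (c - P) w)^°.
have W1P : W1 P by exact: near_w.
pose W := sphere_chart_dom P w' be `&` W1.
have Wo : open W by apply: openI; [exact: open_sphere_chart_dom|exact: open_interior].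
have Wdom : W `<=` sphere_chart_dom P w' be by move=> X [].
have WP : W P by split => //; exact: sphere_chart_dom_base.
have chartE X : W X -> chart_dom ord_max (Phi X) /\ chart ord_max (Phi X) = sphere_chart P w' be X.
  move=> /Wdom[/= den _]; rewrite /Phi PhiE.
  have [|h1 ->] := @chart_vline R ord_max (sphere_row P w' be X).
    by rewrite sphere_row_max gt_eqF.
  split => //; apply/rowP => i; rewrite mxE sphere_row_lift sphere_row_max.
  by rewrite /sphere_chart [RHS]mxE mulrC.
have Wdiffeo : diffeo_onto_image W (fun X => chart ord_max (Phi X)).
  apply: (diffeo_ext _ (sphere_chart_diffeo Wo Wdom)) => X WX.
  by have [_ ->] := chartE _ WX.
split.
  move=> j [_ jP]; have -> : j = ord_max; last exact: (diffeo_jacobian Wdiffeo).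
  apply/eqP; apply: contraNT jP => jmax; rewrite /Phi PhiE.
  have [t _ ->] : exists2 t : R, t != 0 & vpick <[sphere_row P w' be P : 'rV[R]_4]>%VS = t *: (sphere_row P w' be P : 'rV[R]_4).
    apply: vpick_vline; apply/eqP => /rowP/(_ ord_max); rewrite sphere_row_max subrr dot0l mulr0 subr0 mxE.
    by move/eqP; rewrite oner_eq0.
  have [k ->|jE] := unliftP ord_max j; last by rewrite jE eqxx in jmax.
  by rewrite mxE sphere_row_lift subrr dot0l scale0r subr0 mxE mulr0.
exists W; split => //.
  split => //.
  - by move=> X /chartE[[]].
  - move=> X Y WX WY XY; have [_ cX] := chartE _ WX; have [_ cY] := chartE _ WY.
    have [_ <-] := sphere_chartK (Wdom _ WX); have [_ <-] := sphere_chartK (Wdom _ WY).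
    by rewrite -cX -cY XY.
  - by move=> X WX; exists ord_max, W; split => // Y /chartE[].
move=> g Dg [Q [gQ WQ]].
have [cc [n [r [n0 r0 gE]]]] := Dc _ Dg.
have [_ /interior_subset/(_ cc n r n0 r0) /=] := WQ.
rewrite -gE => /(_ Dg); rewrite gE in gQ => /(_ gQ)[nw mw].
have [l [ldim lE]] := line_of_eqs n0 r0 (erefl (dot (cc - P) (cc - P) - r ^+ 2)).
exists l; split => //.
(* The equations of l at Phi X are those of the circle at X: this is what the two
   equations satisfied by w and al mean. *)
have key X : (Phi X <= l)%VS <-> g X.
  rewrite /Phi PhiE lE [X in X == 0]/(sphere_row P w' be X *m _) line_eqs_row gE /=.
  have -> : X - cc = (X - P) - (cc - P) by rewrite opprB addrA subrK.
  rewrite (dotC n w) in nw; rewrite (dotC _ w) in mw.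
  move: (X - P) (cc - P) nw mw => Y m nw mw; rewrite /w' /be.
  have e1 : dot (Y - dot Y Y *: (2^-1 *: w)) n - (1 - al / 2 * dot Y Y) * dot n m = dot (Y - m) n.
    by rewrite !(dotDl, dotNl, dotZl) nw (dotC m n); field.
  have e2 : -2 * dot (Y - dot Y Y *: (2^-1 *: w)) m +
      (dot m m - r ^+ 2) * (1 - al / 2 * dot Y Y) = dot (Y - m) (Y - m) - r ^+ 2.
    have wm : dot w m = (al * (dot m m - r ^+ 2) + 2) / 2 by rewrite mw mulrC mulKf.
    by rewrite !(dotDl, dotNl, dotZl, dotDr, dotNr) wm (dotC m Y); field.
  rewrite e1 e2; split => [/andP[/eqP -> /eqP/subr0_eq ->]//|[-> ->]].
  by rewrite subrr eqxx.
by apply/seteqP; split => X /=; rewrite key => -[].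
Qed.

Theorem theorem2p1 (R : realType) (P : 'rV[R]_3) (U : set 'rV[R]_3)
    (Delta : set (set 'rV[R]_3))
    (hUo : open U) (hUc : connected U) (hUP : U P)
    (hDelta : rich_family U Delta) :
  rectifiable_near P Delta <->
  exists a b c d e : 'I_4 -> R,
    let Phi := sphere_map a b c d e in
    nonzero_jacobian Phi P /\
    exists W : set 'rV[R]_3,
      [/\ W P, rp3_diffeo_onto_image W Phi
        & forall g, Delta g -> g `&` W !=set0 ->
            exists l : {vspace 'rV[R]_4}, rp3_line l /\
              g `&` W = [set X | W X /\ (Phi X <= l)%VS]].
Proof.
split; first exact: sphere_map_of_rectifiable hUP hDelta.
move=> [a [b [c [d [e [_ [W [WP WF Wl]]]]]]]].
exact: rectifiable_of_sphere_map WP WF Wl.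
Qed.
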